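(* Let $M$ be a smooth (second countable) $n$-dimensional manifold and let $N$ be a Polish space. Assume that the cost $c:M\times N\to\mathbb{R}$ is Borel measurable, bounded from below, and satisfies: (i) the family of maps $x\mapsto c(x,y)$ is locally semi-concave in $x$ locally uniformly in $y$; (ii) $c$ satisfies the left twist condition. Let $(\varphi,\psi)$ be a $c$-subsolution, let $$G_{(\varphi,\psi)}=\{(x,y)\in M\times N\mid \psi(y)-\varphi(x)=c(x,y)\},$$ let $\pi_M:M\times N\to M$ be the canonical projection, and let $P=\pi_M(G_{(\varphi,\psi)})\subset M$. Then there exist a Borel countably $(n-1)$-Lipschitz set $E\subset M$ and a Borel measurable map $T:M\to N$ such that $$G_{(\varphi,\psi)}\subset \operatorname{Graph}(T)\cup\pi_M^{-1}(E),\qquad \operatorname{Graph}(T)=\{(x,T(x))\mid x\in M\}.$$ In other words, the part of $G_{(\varphi,\psi)}$ which is above $P\setminus E$ is contained in a Borel graph. More precisely, there exist an increasing sequence of locally semi-convex functions $\varphi_k:M\to\mathbb{R}$, with $\varphi\ge\varphi_{k+1}\ge\varphi_k$ on $M$, and an increasing sequence of Borel subsets $C_k\subset M$ such that: - for $x\in C_k$, the derivative $d_x\varphi_k$ exists, $\varphi_{k+1}(x)=\varphi_k(x)$, and $d_x\varphi_{k+1}=d_x\varphi_k$; - if $C=\bigcup_k C_k$, there exists a Borel countably $(n-1)$-Lipschitz set $E\subset M$ such that $P\setminus E\subset C$. Moreover, the Borel map $T:M\to N$ is such that: - for every $x\in C_k$, $(x,T(x))=\Lambda_c^{l,inv}(x,-d_x\varphi_k)$;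 - if $x\in (P\cap C_k)\setminus E$, then the partial derivative $\frac{\partial c}{\partial x}(x,T(x))$ exists (i.e. $(x,T(x))\in\mathcal D(\Lambda_c^l)$) and $\frac{\partial c}{\partial x}(x,T(x))=-d_x\varphi_k$. In particular, if $x\in (P\cap C_k)\setminus E$, then $(x,T(x))\in\mathcal D(\Lambda_c^l)$ and $\Lambda_c^l(x,T(x))=(x,-d_x\varphi_k)$. Therefore, thanks to the twist condition, the map $T$ is uniquely defined on $P\setminus E\subset C$.
   Context: Manifolds are Hausdorff. $c$-subsolution: a pair of functions $\varphi:M\to\mathbb{R}\cup\{+\infty\}$, $\psi:N\to\mathbb{R}\cup\{-\infty\}$ with $\psi(y)-\varphi(x)\le c(x,y)$ for all $(x,y)\in M\times N$. Semi-concavity: a modulus is a continuous non-decreasing $\omega:[0,\infty)\to[0,\infty)$ with $\omega(0)=0$. For $U\subset\mathbb{R}^n$ open, $f:U\to\mathbb{R}$ is $\omega$-semi-concave if for each $x\in U$ there is a linear form $l_x$ with $f(y)-f(x)\le l_x(y-x)+\|y-x\|\,\omega(\|y-x\|)$ for all $y\in U$. It is locally semi-concave if each point of $U$ has an open neighborhood on which $f$ is $\omega$-semi-concave for some modulus $\omega$. A function on a manifold is locally semi-concave if it is so when read in charts, and $f$ is locally semi-convex if $-f$ is locally semi-concave. A family $(f_i)_{i\in I}$ of functions on $M$ is uniformly locally semi-concave if $M$ is covered by domains $U_j$ of charts $\theta_j$ such that, for each $j$, there is a single modulus $\omega_j$ for which all $f_i\circ\theta_j^{-1}$, $i\in I$,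 are $\omega_j$-semi-concave on $\theta_j(U_j)$. Condition (i) means: each $y_0\in N$ has a neighborhood $V_0$ such that the family $(c(\cdot,y))_{y\in V_0}$ is uniformly locally semi-concave on $M$. Left twist condition: let $\mathcal D(\Lambda_c^l)=\{(x,y)\in M\times N\mid \frac{\partial c}{\partial x}(x,y)\text{ exists}\}$ and $\Lambda_c^l:\mathcal D(\Lambda_c^l)\to T^*M$, $\Lambda_c^l(x,y)=(x,\frac{\partial c}{\partial x}(x,y))$. The left twist condition says that $\Lambda_c^l$ is injective on $\mathcal D(\Lambda_c^l)$. Here $\mathcal D(\Lambda_c^l)$ and $\Lambda_c^l(\mathcal D(\Lambda_c^l))$ are Borel sets and the inverse $(\Lambda_c^l)^{-1}$ on the image is a Borel map; it is extended to a Borel map $\Lambda_c^{l,inv}:T^*M\to M\times N$ by setting $\Lambda_c^{l,inv}(x,p)=(x,\bar y)$ when $(x,p)\notin\Lambda_c^l(\mathcal D(\Lambda_c^l))$, where $\bar y\in N$ is an arbitrary fixed point. Countably $(n-1)$-Lipschitz: $E\subset\mathbb{R}^n$ is countably $(n-1)$-Lipschitz if it is contained in a countable union of compact sets $K_j$ such that, for each $j$, there is a hyperplane $H_j$ with $\mathbb{R}^n=H_j\oplus H_j^\perp$ and $K_j$ contained in the graph of a Lipschitz function $f_j:A_j\to H_j^\perp$ with $A_j\subset H_j$ compact. On an $n$-dimensional manifold the notion is understood in charts.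
   Formalization: The part with the functions φ_k and sets C_k assumes that ψ is not identically −∞; otherwise it fails, e.g. M=ℝ, N a point, c=0, ψ=−∞, φ(x)=−1/|x|, φ(0)=0. The inclusion of G in Graph(T)∪π_M^{-1}(E) is proved without this. *)

(* Defs.v *)
From HB Require Import structures.
From mathcomp Require Import all_boot all_order all_algebra.
From mathcomp Require Import all_classical all_reals all_analysis.
Set Implicit Arguments.
Unset Strict Implicit.
Unset Printing Implicit Defensive.
Import Order.TTheory GRing.Theory Num.Theory.
Import numFieldNormedType.Exports.
Local Open Scope classical_set_scope.
Local Open Scope ring_scope.

Definition borel (T : topologicalType) : set (set T) := <<s [set U : set T | open U] >>.

Definition borel_fun (S T : topologicalType) (f : S -> T) : Prop :=
  forall B : set T, borel B -> borel (f @^-1` B).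

Definition polish_space (R : realType) (T : topologicalType) : Prop :=
  (exists d : T -> T -> R,
    [/\ forall x y, d x y = 0 <-> x = y,
        forall x y, d x y = d y x,
        forall x y z, d x z <= d x y + d y z,
        forall x (A : set T),
          nbhs x A <-> exists2 e : R, 0 < e & [set y | d x y < e] `<=` A &
        forall u : nat -> T,
          (forall e : R, 0 < e -> exists k, forall i j,
             (k <= i)%N -> (k <= j)%N -> d (u i) (u j) < e) ->
          exists l : T, u @ \oo --> l]) /\
  (exists2 Q : set T, countable Q & dense Q).

(* [v |-> 'd f x v] being C^k for every fixed [v] is the same as [df] being C^k,
   since the spaces below are finite-dimensional. *)
Fixpoint Ck (R : realType) (V W : normedModType R) (k : nat) (U : set V)
    (f : V -> W) : Prop :=
  if k is k'.+1 then
    (forall x, U x -> differentiable f x) /\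
    (forall v, Ck k' U (fun x => 'd f x v))
  else forall x, U x -> {for x, continuous f}.

Definition smooth_on (R : realType) (V W : normedModType R) (U : set V)
    (f : V -> W) : Prop := forall k, Ck k U f.

(* The values of [chart_map] outside [chart_dom], and those of [chart_inv]
   outside the image of [chart_dom], are irrelevant. *)
Record chart (R : realType) (n : nat) (M : topologicalType) := Chart {
  chart_dom : set M ;
  chart_map :> M -> 'rV[R]_n ;
  chart_inv : 'rV[R]_n -> M ;
  chart_dom_open : open chart_dom ;
  chart_img_open : open (chart_map @` chart_dom) ;
  chart_mapK : forall x, chart_dom x -> chart_inv (chart_map x) = x ;
  chart_map_continuous : forall x, chart_dom x -> {for x, continuous chart_map} ;
  chart_inv_continuous : forall u, (chart_map @` chart_dom) u ->
    {for u, continuous chart_inv} }.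

Definition chart_img (R : realType) (n : nat) (M : topologicalType)
  (a : chart R n M) : set 'rV[R]_n := a @` chart_dom a.

Definition transition (R : realType) (n : nat) (M : topologicalType)
  (a b : chart R n M) : 'rV[R]_n -> 'rV[R]_n := b \o chart_inv a.

Definition chart_compatible (R : realType) (n : nat) (M : topologicalType)
    (a b : chart R n M) : Prop :=
  smooth_on (a @` (chart_dom a `&` chart_dom b)) (transition a b) /\
  smooth_on (b @` (chart_dom a `&` chart_dom b)) (transition b a).

Record smooth_structure (R : realType) (n : nat) (M : topologicalType) :=
  SmoothStructure {
    atlas : set (chart R n M) ;
    atlas_cover : forall x, exists2 a, atlas a & chart_dom a x ;
    atlas_compatible : forall a b, atlas a -> atlas b -> chart_compatible a b ;
    atlas_maximal : forall a,
      (forall b, atlas b -> chart_compatible a b) -> atlas a }.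

Section Manifold.
Context (R : realType) (n : nat) (M : topologicalType).
Context (S : smooth_structure R n M).

Definition chart_at (x : M) := {a : chart R n M | atlas S a /\ chart_dom a x}.

(* A cotangent vector at x assigns to each chart at x a linear form on R^n, in
   such a way that the transition maps pull these forms back to one another. *)
Record covector (x : M) := Covector {
  covec :> chart_at x -> {linear 'rV[R]_n -> R^o} ;
  covec_compatible : forall (a b : chart_at x) (v : 'rV[R]_n),
    covec a v = covec b ('d (transition (sval a) (sval b)) (sval a x) v) }.

Definition covec0 (x : M) : covector x.
Proof. by exists (fun=> \0). Defined.

Definition covec_opp (x : M) (p : covector x) : covector x.
Proof.
exists (fun a => \- p a) => a b v /=.
by congr (- _); apply: covec_compatible.
Defined.

Definition cotangent_bundle := {x : M & covector x}.

Definition has_differential (f : M -> R) (x : M) (p : covector x) : Prop :=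
  forall a : chart_at x,
    let fa : 'rV[R]_n -> R^o := f \o chart_inv (sval a) in
    differentiable fa (sval a x) /\ forall v, 'd fa (sval a x) v = p a v.

Definition differentiable_at (f : M -> R) (x : M) : Prop :=
  exists p : covector x, has_differential f p.

(* 0 when [f] is not differentiable at [x] *)
Definition differential (f : M -> R) (x : M) : covector x :=
  if pselect (differentiable_at f x) is left h then sval (cid h) else covec0 x.

End Manifold.

Definition modulus (R : realType) (w : R -> R) : Prop :=
  [/\ {within [set r | 0 <= r], continuous w},
      forall r s, 0 <= r -> r <= s -> w r <= w s,
      forall r, 0 <= r -> 0 <= w r & w 0 = 0].

(* [`|_|] is the sup norm of R^n; as the moduli are always quantified
   existentially, any other norm gives the same locally semi-concave functions. *)
Definition semiconcave (R : realType) (n : nat) (w : R -> R)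
    (U : set 'rV[R]_n) (f : 'rV[R]_n -> R) : Prop :=
  forall x, U x -> exists l : {linear 'rV[R]_n -> R^o}, forall y, U y ->
    f y - f x <= l (y - x) + `|y - x| * w `|y - x|.

Definition locally_semiconcave_on (R : realType) (n : nat)
    (U : set 'rV[R]_n) (f : 'rV[R]_n -> R) : Prop :=
  forall x, U x -> exists V : set 'rV[R]_n,
    [/\ open V, V x, V `<=` U &
        exists2 w : R -> R, modulus w & semiconcave w V f].

Definition hyperplane (R : realType) (n : nat) (H : {vspace 'rV[R]_n}) : Prop :=
  (\dim H).+1 = n.

Definition orthogonal_compl (R : realType) (n : nat) (H : {vspace 'rV[R]_n}) :
    set 'rV[R]_n :=
  [set v | forall w, w \in H -> (v *m w^T) 0 0 = 0].

Definition in_lipschitz_graph (R : realType) (n : nat) (K : set 'rV[R]_n) : Prop :=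
  exists (H : {vspace 'rV[R]_n}) (A : set 'rV[R]_n) (f : 'rV[R]_n -> 'rV[R]_n),
    [/\ hyperplane H,
        compact A /\ A `<=` [set a | a \in H],
        (forall a, A a -> orthogonal_compl H (f a)),
        [lipschitz f x | x in A] &
        K `<=` [set a + f a | a in A]].

Definition countably_lipschitz_on (R : realType) (n : nat) (E : set 'rV[R]_n) :
    Prop :=
  exists KK : set (set 'rV[R]_n),
    [/\ countable KK,
        forall K, KK K -> compact K /\ in_lipschitz_graph K &
        E `<=` \bigcup_(K in KK) K].

Section ManifoldNotions.
Context (R : realType) (n : nat) (M : topologicalType).
Context (S : smooth_structure R n M).

Definition locally_semiconcave (f : M -> R) : Prop :=
  forall a, atlas S a -> locally_semiconcave_on (chart_img a) (f \o chart_inv a).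

Definition locally_semiconvex (f : M -> R) : Prop :=
  locally_semiconcave (fun x => - f x).

Definition uniformly_locally_semiconcave (I : Type) (D : set I)
    (f : I -> M -> R) : Prop :=
  exists AA : set (chart R n M),
    [/\ AA `<=` atlas S,
        \bigcup_(a in AA) chart_dom a = setT &
        forall a, AA a -> exists2 w : R -> R, modulus w &
          forall i, D i -> semiconcave w (chart_img a) (f i \o chart_inv a)].

Definition countably_lipschitz (E : set M) : Prop :=
  forall a, atlas S a -> countably_lipschitz_on (a @` (E `&` chart_dom a)).

Context (N : topologicalType) (c : M * N -> R).

Definition semiconcave_locally_uniformly : Prop :=
  forall y0 : N, exists2 V : set N, nbhs y0 V &
    uniformly_locally_semiconcave V (fun y x => c (x, y)).

Definition left_twist_dom : set (M * N) :=
  [set z | differentiable_at S (fun x => c (x, z.2)) z.1].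

Definition left_twist (z : M * N) : cotangent_bundle S :=
  existT _ z.1 (differential S (fun x => c (x, z.2)) z.1).

Definition left_twist_condition : Prop := set_inj left_twist_dom left_twist.

Definition left_twist_inv (ybar : N) (q : cotangent_bundle S) : M * N :=
  xget (tag q, ybar) [set z | left_twist_dom z /\ left_twist z = q].

End ManifoldNotions.

Section Subsolution.
Context (R : realType) (M N : Type) (c : M * N -> R).
Context (phi : M -> \bar R) (psi : N -> \bar R).

Definition c_subsolution : Prop :=
  [/\ forall x, phi x != -oo%E, forall y, psi y != +oo%E &
      forall x y, (psi y - phi x <= (c (x, y))%:E)%E].

Definition contact_set : set (M * N) :=
  [set z | (psi z.2 - phi z.1)%E = (c z)%:E].

End Subsolution.

Definition graph_of (M N : Type) (T : M -> N) : set (M * N) :=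
  [set z | z.2 = T z.1].

(* Main.v *)
Require Import Defs.
From HB Require Import structures.
From mathcomp Require Import all_boot all_order all_algebra.
From mathcomp Require Import all_classical all_reals all_analysis.
From mathcomp Require Import ring lra.
Import Order.TTheory GRing.Theory Num.Theory.
Import numFieldNormedType.Exports.
Local Open Scope classical_set_scope.
Local Open Scope ring_scope.
Set Implicit Arguments.
Unset Strict Implicit.
Unset Printing Implicit Defensive.

(** By definition of a c-subsolution, [phi] dominates [psi y - c (., y)] for every
    [y], with equality at the points of the contact set. Cover [N] by countably
    many open sets on each of which the functions [c (., y)] share their moduli
    of semi-concavity, and let [phi_ k] be the supremum of [psi y - c (., y)] over
    the [y] that lie in the first [k] of these sets and satisfy [psi y <= k], and
    one fixed [y] that keeps this set nonempty. The bound on [psi] and the lower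
    bound on [c] make the supremum finite; a supremum of semi-convex functions with
    a common modulus is semi-convex, because limits of subgradients of members that
    nearly attain it are subgradients ([semiconcave_inf]). Since the moduli are
    only common in charts that depend on the piece of [N], one takes the supremum
    piece by piece and moves the result to other charts: there
    [locally_semiconcave_comp] applies, the charts being related by C^2 maps, for a
    single function, whose supergradients are locally bounded
    ([semiconvex_approximation]).

    Let [E] be the set of points where some [phi_ k] fails to be differentiable. At
    such a point a semi-concave function has two distinct supergradients
    ([two_supergradients]). If two points are close and have almost the same pair
    of supergradients [p <> q], adding the inequalities at both points eliminates
    the function and shows that their difference is almost orthogonal to [p - q];
    hence, sorting the points by rational approximations of [p] and [q], [E] is
    contained in a countable union of Lipschitz graphs over hyperplanes orthogonal
    to [p - q] ([countably_lipschitz_two_supergradients]). It is Borel because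
    differentiability of a semi-concave function is a condition on symmetric second
    differences along rational vectors ([borel_differentiability]).

    Above a point [(x, y)] of the contact set, [phi_ k x = phi x] for large [k], and
    [phi_ k + c (., y)] has a minimum at [x]. If [x] is not in [E], the semi-concave
    function [c (., y)] lies above the differentiable function [- phi_ k], up to a
    constant, with contact at [x]; so it is differentiable there with differential
    [- d phi_ k] ([left_twist_contact]), and the twist condition determines [y].
    With [C k] the set of points outside [E] where [phi_ l = phi_ k] for all
    [l >= k], the differentials of the [phi_ l] agree on [C k], so that the pairs
    [(x, y)] with [x] in some [C k] and [c (., y) + phi_ k] critical at [x] form the
    graph of a partial map [T].

    This graph is Borel: criticality is tested on rational vectors, in countably
    many charts, so it is enough that [c] is Borel in the pair ([borel_critical]).
    That a map with a Borel graph has a Borel domain and is Borel is the theorem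
    of Lusin and Souslin. It is proved here through Suslin sets, the continuous
    images of closed sets of sequences of natural numbers: Borel sets are Suslin
    ([borel_suslin]), disjoint Suslin sets are separated by Borel sets
    ([lusin_separation]), and a separation for each ball of a countable basis of
    [N] recovers the map ([borel_fun_of_borel_graph]). *)

(** * Borel sets *)

Section BorelSets.
Context (T : topologicalType).
Implicit Types A B : set T.

Lemma borel_open A : open A -> borel A.
Proof. by move=> oA; apply: sub_sigma_algebra. Qed.

Lemma borel0 : borel (set0 : set T).
Proof. by apply: borel_open; apply: open0. Qed.

Lemma borelT : borel [set: T].
Proof. by apply: borel_open; apply: openT. Qed.

Lemma borelC A : borel A -> borel (~` A).
Proof. by move=> bA; rewrite -setTD; apply: sigma_algebraCD. Qed.

Lemma borel_closed A : closed A -> borel A.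
Proof. by move=> cA; rewrite -(setCK A); apply: borelC; apply: borel_open; apply: closed_openC. Qed.

Lemma borel_bigcup_nat (F : nat -> set T) :
  (forall i, borel (F i)) -> borel (\bigcup_i F i).
Proof. exact: sigma_algebra_bigcup. Qed.

Lemma borel_bigcup (I : Type) (D : set I) (F : I -> set T) :
  countable D -> (forall i, D i -> borel (F i)) -> borel (\bigcup_(i in D) F i).
Proof.
move=> /countable_injP[f injf] bF.
have -> : \bigcup_(i in D) F i =
    \bigcup_n (\bigcup_(i in [set i | D i /\ f i = n]) F i).
  apply/seteqP; split=> [x [i Di Fx]|x [m _ [i [Di _] Fx]]]; last by exists i.
  by exists (f i) => //; exists i.
apply: borel_bigcup_nat => m.
have [[i [Di fi]]|no] := pselect (exists i, D i /\ f i = m); last first.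
  rewrite (_ : \bigcup_(_ in _) _ = set0); first exact: borel0.
  by apply/seteqP; split=> // x [i Di _]; apply: no; exists i.
rewrite (_ : \bigcup_(_ in _) _ = F i); first exact: bF.
apply/seteqP; split=> [x [j [Dj fj]]|x Fx]; last by exists i.
suff -> : j = i by [].
by apply: injf; rewrite ?inE // fi fj.
Qed.

Lemma borel_bigcap (I : Type) (D : set I) (F : I -> set T) :
  countable D -> (forall i, D i -> borel (F i)) -> borel (\bigcap_(i in D) F i).
Proof.
move=> cD bF; rewrite -(setCK (\bigcap_(_ in _) _)) setC_bigcap.
by apply: borelC; apply: borel_bigcup => // i Di; apply: borelC; apply: bF.
Qed.

Lemma borel_exists (I : countType) (F : I -> set T) :
  (forall i, borel (F i)) -> borel [set x | exists i, F i x].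
Proof.
move=> bF; rewrite (_ : [set _ | _] = \bigcup_i F i).
  by apply: borel_bigcup.
by apply/seteqP; split=> x [i]; exists i.
Qed.

Lemma borel_forall (I : countType) (F : I -> set T) :
  (forall i, borel (F i)) -> borel [set x | forall i, F i x].
Proof.
move=> bF; rewrite (_ : [set _ | _] = \bigcap_i F i).
  by apply: borel_bigcap.
by apply/seteqP; split=> x Fx i //; apply: Fx.
Qed.

Lemma borelU A B : borel A -> borel B -> borel (A `|` B).
Proof.
move=> bA bB; rewrite -bigcup2E; apply: borel_bigcup_nat => -[|[|i]] //=.
exact: borel0.
Qed.

Lemma borelI A B : borel A -> borel B -> borel (A `&` B).
Proof.
by move=> bA bB; rewrite -(setCK (A `&` B)) setCI; apply: borelC; apply: borelU; apply: borelC.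
Qed.

Lemma borelD A B : borel A -> borel B -> borel (A `\` B).
Proof. by move=> bA bB; rewrite setDE; apply: borelI => //; apply: borelC. Qed.

Lemma borel_ind (Q : set (set T)) :
  (forall A, open A -> Q A) -> (forall A, Q A -> Q (~` A)) ->
  (forall F : nat -> set T, (forall i, Q (F i)) -> Q (\bigcup_i F i)) ->
  @borel T `<=` Q.
Proof.
move=> Qo QC QU; apply: smallest_sub; last by move=> A /Qo.
by split=> // [|A QA]; [apply: Qo; apply: open0 | rewrite setTD; apply: QC].
Qed.

End BorelSets.

(** Charts and their inverses are continuous only on open sets, and have arbitrary
    values elsewhere. *)
Lemma borel_preimage_open (S T : topologicalType) (U : set S) (f : S -> T)
    (B : set T) :
  open U -> (forall x, U x -> {for x, continuous f}) -> borel B ->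
  borel (U `&` f @^-1` B).
Proof.
move=> oU cf; move: B; apply: borel_ind => [B oB|B IH|F IH].
- apply: borel_open; rewrite openE => x [Ux Bfx].
  apply: filterI; first exact: open_nbhs_nbhs.
  by apply: (cf x Ux); apply: open_nbhs_nbhs.
- rewrite (_ : _ `&` _ = U `\` (U `&` f @^-1` B)).
    by apply: borelD => //; apply: borel_open.
  by rewrite setDIr setDv set0U setDE -preimage_setC.
- rewrite preimage_bigcup setI_bigcupr; exact: borel_bigcup_nat.
Qed.

Lemma borel_preimage (S T : topologicalType) (f : S -> T) (B : set T) :
  continuous f -> borel B -> borel (f @^-1` B).
Proof.
move=> cf bB; rewrite -[_ @^-1` _]setTI.
by apply: borel_preimage_open => //; [apply: openT | move=> x _; apply: cf].
Qed.

(** Over a second-countable factor every open set of a product is a countable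
    union of open rectangles, so a pair of Borel maps is Borel. *)
Lemma borel_fun_pair (S X Y : topologicalType) (f : S -> X) (g : S -> Y) :
  @second_countable Y -> borel_fun f -> borel_fun g ->
  borel_fun (fun s => (f s, g s)).
Proof.
move=> [K cK [openK baseK]] bf bg; apply: borel_ind => [W oW|B|F bF].
- pose U (o : set Y) :=
    \bigcup_(V in [set V : set X | open V /\ V `*` o `<=` W]) V.
  rewrite (_ : _ @^-1` _ = \bigcup_(o in K) (f @^-1` U o `&` g @^-1` o)).
    apply: borel_bigcup => // o Oo; apply: borelI.
      by apply: bf; apply: borel_open; apply: bigcup_open => V [].
    by apply: bg; apply: borel_open; apply: openK.
  apply/seteqP; split=> [s /= Ws|s [k Kk [[V [oV VW] Vs] ks]]]; last first.
    by apply: VW.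
  have [[A B] /= [nA nB] AB] := open_nbhs_nbhs (conj oW Ws).
  have [k [Kk ks] kB] := baseK (g s) B nB.
  exists k => //; split=> //.
  exists (interior A) => /=; last by [].
  split; first exact: open_interior.
  by move=> [a b] [/= /interior_subset Aa kb]; apply: AB; split=> //; apply: kB.
- exact: borelC.
- rewrite preimage_bigcup; exact: borel_bigcup_nat.
Qed.

Lemma borel_fun_open (S T : topologicalType) (f : S -> T) :
  (forall U : set T, open U -> borel (f @^-1` U)) -> borel_fun f.
Proof.
move=> bf; apply: borel_ind => // [B|F bF]; first exact: borelC.
rewrite preimage_bigcup; exact: borel_bigcup_nat.
Qed.

Lemma borel_cst (T : topologicalType) (Q : Prop) : borel [set _ : T | Q].
Proof.
have [q|nq] := pselect Q.
  by rewrite (_ : [set _ | _] = setT); [exact: borelT | apply/seteqP; split].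
by rewrite (_ : [set _ | _] = set0); [exact: borel0 | apply/seteqP; split].
Qed.

Lemma borel_fun_if (S T : topologicalType) (A : set S) (f : S -> T) (t : T) :
  borel A -> (forall U : set T, open U -> borel (A `&` f @^-1` U)) ->
  borel_fun (fun x => if pselect (A x) then f x else t).
Proof.
move=> bA bf; apply: borel_fun_open => U oU.
rewrite (_ : _ @^-1` _ = (A `&` f @^-1` U) `|` (~` A `&` [set _ | U t])).
  apply: borelU; first exact: bf.
  by apply: borelI; [exact: borelC | exact: borel_cst].
apply/seteqP; split=> x /=; case: pselect => Ax /=.
- by left.
- by right.
- by case=> -[].
- by case=> -[].
Qed.

(** * Suslin sets and Lusin separation *)

Definition agree (n : nat) (a b : nat -> nat) := forall i, (i < n)%N -> a i = b i.

Lemma agree_sym n a b : agree n a b -> agree n b a.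
Proof. by move=> ab i /ab. Qed.

Lemma agree_trans n a b c : agree n a b -> agree n b c -> agree n a c.
Proof. by move=> ab bc i ltin; rewrite ab // bc. Qed.

Lemma agree_le m n a b : (m <= n)%N -> agree n a b -> agree m a b.
Proof. by move=> lemn ab i ltim; apply: ab; apply: leq_trans lemn. Qed.

Lemma agree0 a : agree 0 a = setT.
Proof. by apply/seteqP; split. Qed.

Lemma agree_eq n a b : agree n a b -> agree n a = agree n b.
Proof.
move=> ab; apply/seteqP; split=> c; last exact: agree_trans.
exact/agree_trans/agree_sym.
Qed.

(** These two notions are closedness in the Baire space of sequences and
    continuity on a part of it, spelled out on its basis of neighbourhoods, the
    sets of sequences with a given initial segment. *)
Definition baire_closed (F : set (nat -> nat)) : Prop :=
  forall a, (forall n, exists2 b, F b & agree n a b) -> F a.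

Definition baire_continuous (X : topologicalType) (F : set (nat -> nat))
    (f : (nat -> nat) -> X) : Prop :=
  forall a, F a -> forall U, nbhs (f a) U ->
    exists n, forall b, F b -> agree n a b -> U (f b).

(** Codes range over a closed set of sequences rather than over all of them, so
    that countable intersections can be coded by constrained families of codes. *)
Definition suslin (X : topologicalType) (A : set X) : Prop :=
  exists (F : set (nat -> nat)) (f : (nat -> nat) -> X),
    [/\ baire_closed F, baire_continuous F f & f @` F = A].

Definition tail (a : nat -> nat) : nat -> nat := fun i => a i.+1.

Definition cons_seq (k : nat) (a : nat -> nat) : nat -> nat :=
  fun i => if i is j.+1 then a j else k.

(** A sequence codes a sequence of sequences, its tracks, through the pairing of
    natural numbers. *)
Definition track (i : nat) (a : nat -> nat) : nat -> nat :=
  fun m => a (pickle (i, m)).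

Definition untrack (b : nat -> nat -> nat) : nat -> nat :=
  fun k => if unpickle k is Some im then b im.1 im.2 else 0%N.

Lemma untrackK b i : track i (untrack b) = b i.
Proof. by apply/funext => m; rewrite /track /untrack pickleK. Qed.

Lemma agree_tail n a b : agree n.+1 a b -> agree n (tail a) (tail b).
Proof. by move=> ab i ltin; apply: ab. Qed.

(** Each track depends continuously on the sequence. *)
Lemma agree_track i n : exists m, forall a b, agree m a b ->
  agree n (track i a) (track i b).
Proof.
exists (\max_(j < n) (pickle (i, j : nat)).+1) => a b ab j ltjn; apply: ab.
exact: (@leq_bigmax _ (fun j : 'I_n => (pickle (i, j : nat)).+1) (Ordinal ltjn)).
Qed.

Lemma hausdorff_separate (X : topologicalType) (x y : X) : hausdorff_space X ->
  x <> y -> exists U V, [/\ open U, open V, U x, V y & U `&` V = set0].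
Proof.
rewrite open_hausdorff => hX /eqP/hX[[U V] /= [/set_mem Ux /set_mem Vy]].
by move=> [oU oV /eqP UV]; exists U, V.
Qed.

Section SuslinOperations.
Context (X : topologicalType).
Implicit Types A B : set X.

Lemma suslin_image (Y : topologicalType) (g : X -> Y) A :
  (forall x, A x -> {for x, continuous g}) -> suslin A -> suslin (g @` A).
Proof.
move=> cg [F [f [clF cf eqA]]]; rewrite -eqA in cg *.
exists F, (g \o f); split; first exact: clF.
  move=> a Fa U /(cg (f a) (ex_intro2 _ _ a Fa erefl)) nU.
  by have [n fU] := cf a Fa _ nU; exists n.
by rewrite image_comp.
Qed.

Lemma suslin_bigcup (A : nat -> set X) :
  (forall i, suslin (A i)) -> suslin (\bigcup_i A i).
Proof.
move=> /choice[F /choice[f Ff]].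
have clF i := let: And3 h _ _ := Ff i in h.
have cf i := let: And3 _ h _ := Ff i in h.
have im i := let: And3 _ _ h := Ff i in h.
exists [set a | F (a 0%N) (tail a)], (fun a => f (a 0%N) (tail a)); split.
- move=> a clo; apply: clF => n; have [b Fb ab] := clo n.+1.
  by exists (tail b); [rewrite ab | apply: agree_tail].
- move=> a Fa U nU; have [n fU] := cf _ _ Fa U nU.
  exists n.+1 => b /= Fb ab; have b0 : b 0%N = a 0%N by rewrite ab.
  by rewrite b0 in Fb *; apply: fU => //; apply: agree_tail.
- apply/seteqP; split=> [_ [a Fa <-]|x [i _]].
    by exists (a 0%N) => //; rewrite -im; exists (tail a).
  by rewrite -im => -[a Fa <-]; exists (cons_seq i a).
Qed.

(** A common point of the sets is coded by codes of it in all of them; the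
    Hausdorff property makes the agreement of the coded points a closed
    condition. *)
Lemma suslin_bigcap (A : nat -> set X) : hausdorff_space X ->
  (forall i, suslin (A i)) -> suslin (\bigcap_i A i).
Proof.
move=> hX /choice[F /choice[f Ff]].
have clF i := let: And3 h _ _ := Ff i in h.
have cf i := let: And3 _ h _ := Ff i in h.
have im i := let: And3 _ _ h := Ff i in h.
exists [set a | forall i, F i (track i a) /\ f i (track i a) = f 0%N (track 0 a)].
exists (fun a => f 0%N (track 0 a)); split.
- move=> a clo; have Fa i : F i (track i a).
    apply: clF => n; have [m agm] := agree_track i n.
    by have [b Fb /agm ab] := clo m; exists (track i b) => //; case: (Fb i).
  move=> i; split=> //; apply: contrapT => /(hausdorff_separate hX).
  move=> [U [V [oU oV Ux Vx UV]]].
  have [n nU] := cf i _ (Fa i) U (open_nbhs_nbhs (conj oU Ux)).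
  have [p pV] := cf 0%N _ (Fa 0%N) V (open_nbhs_nbhs (conj oV Vx)).
  have [n' agn] := agree_track i n; have [p' agp] := agree_track 0 p.
  have [b Fb ab] := clo (maxn n' p'); have [Fbi eqb] := Fb i.
  suff : (U `&` V) (f i (track i b)) by rewrite UV.
  split; first by apply: nU => //; apply: agn; apply: agree_le ab; apply: leq_maxl.
  rewrite eqb; apply: pV; first by case: (Fb 0%N).
  by apply: agp; apply: agree_le ab; apply: leq_maxr.
- move=> a Fa U nU; have [n fU] := cf _ _ (proj1 (Fa 0%N)) U nU.
  have [m agm] := agree_track 0 n; exists m => b Fb /agm ab.
  by apply: fU => //; case: (Fb 0%N).
- apply/seteqP; split=> [_ [a Fa <-] i _|x Ax].
    by rewrite -im; have [Fi <-] := Fa i; exists (track i a).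
  have /choice[b Fb] : forall i, exists b, F i b /\ f i b = x.
    by move=> i; have := Ax i I; rewrite -im => -[b]; exists b.
  exists (untrack b) => [i|]; rewrite !untrackK; last by case: (Fb 0%N).
  by have [? ->] := Fb i; have [_ ->] := Fb 0%N.
Qed.

Lemma suslin_setI_closed A B : suslin A -> closed B -> suslin (A `&` B).
Proof.
move=> [F [f [clF cf <-]]] clB; exists (F `&` f @^-1` B), f; split.
- move=> a clo; have Fa : F a.
    by apply: clF => n; have [b [Fb _] ab] := clo n; exists b.
  split=> //; apply: contrapT => nBa.
  have [n fB] := cf a Fa (~` B) (open_nbhs_nbhs (conj (closed_openC clB) nBa)).
  by have [b [Fb Bb] ab] := clo n; apply: (fB b).
- move=> a [Fa _] U /(cf a Fa)[n fU]; exists n => b [Fb _]; exact: fU.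
- apply/seteqP; split=> [_ [a [Fa Ba] <-]|_ [[a Fa <-] Ba]]; last by exists a.
  by split=> //; exists a.
Qed.

(** A point of the trace is coded by a code [b] of it in [A], preceded by the
    length of an initial segment of [b] that already forces the coded point
    into the open set. *)
Lemma suslin_setI_open A B : suslin A -> open B -> suslin (A `&` B).
Proof.
move=> [F [f [clF cf <-]]] oB.
exists [set a | F (tail a) /\
  forall b, F b -> agree (a 0%N) (tail a) b -> B (f b)], (f \o tail); split.
- move=> a clo; split.
    apply: clF => n; have [b [Fb _] ab] := clo n.+1.
    by exists (tail b) => //; apply: agree_tail.
  have [b [_ Bb] ab] := clo (a 0%N).+1 => c Fc ac; apply: Bb => //.
  by rewrite -ab //; apply: agree_trans ac; apply/agree_sym/agree_tail.
- move=> a [Fa _] U /(cf _ Fa)[n fU]; exists n.+1 => b [Fb _] ab.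
  by apply: fU => //; apply: agree_tail.
- apply/seteqP; split=> [_ [a [Fa Ba] <-]|_ [[a Fa <-] Ba]].
    by split; [exists (tail a) | apply: Ba].
  have [n fB] := cf a Fa B (open_nbhs_nbhs (conj oB Ba)).
  by exists (cons_seq n a).
Qed.

Lemma suslin_setX (Y : topologicalType) A (B : set Y) :
  suslin A -> suslin B -> suslin (A `*` B).
Proof.
move=> [F [f [clF cf <-]]] [G [g [clG cg <-]]].
exists [set a | F (track 0 a) /\ G (track 1 a)].
exists (fun a => (f (track 0 a), g (track 1 a))); split.
- move=> a clo; split; [apply: clF => n | apply: clG => n].
    have [m agm] := agree_track 0 n; have [b [Fb _] ab] := clo m.
    by exists (track 0 b) => //; apply: agm.
  have [m agm] := agree_track 1 n; have [b [_ Gb] ab] := clo m.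
  by exists (track 1 b) => //; apply: agm.
- move=> a [Fa Ga] W [[U V] /= [nU nV] UV].
  have [n fU] := cf _ Fa U nU; have [m gV] := cg _ Ga V nV.
  have [n' agn] := agree_track 0 n; have [m' agm] := agree_track 1 m.
  exists (maxn n' m') => b [Fb Gb] ab; apply: UV; split=> /=.
    by apply: fU => //; apply: agn; apply: agree_le ab; apply: leq_maxl.
  by apply: gV => //; apply: agm; apply: agree_le ab; apply: leq_maxr.
- apply/seteqP; split=> [_ [a [Fa Ga] <-]|[_ _] [/= [a Fa <-] [b Gb <-]]].
    by split=> /=; [exists (track 0 a) | exists (track 1 a)].
  by exists (untrack (fun i => if i is 0%N then a else b)); rewrite /= !untrackK.
Qed.

(** Suslin sets need not be stable under complement, so the induction is on the
    sets that are Suslin together with their complement. *)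
Lemma borel_suslin B : hausdorff_space X -> suslin [set: X] ->
  borel B -> suslin B.
Proof.
move=> hX sX bB; suff [] : suslin B /\ suslin (~` B) by [].
move: B bB; apply: borel_ind => [B oB|B []|F sF]; last 1 first.
- split; first by apply: suslin_bigcup => i; case: (sF i).
  by rewrite setC_bigcup; apply: suslin_bigcap => // i; case: (sF i).
- split; rewrite -[X in suslin X]setTI; first exact: suslin_setI_open.
  by apply: suslin_setI_closed => //; apply: open_closedC.
- by rewrite setCK.
Qed.

Definition borel_separated A B : Prop :=
  exists S, [/\ borel S, A `<=` S & B `<=` ~` S].

(** This is what lets a failure of separation be refined: if no separating sets
    exist for two unions, none exist for some pair of members. *)
Lemma borel_separated_bigcup (A B : nat -> set X) :
  (forall i j, borel_separated (A i) (B j)) ->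
  borel_separated (\bigcup_i A i) (\bigcup_j B j).
Proof.
move=> sAB; have /choice[S SP] : forall i, exists S : nat -> set X, forall j,
    [/\ borel (S j), A i `<=` S j & B j `<=` ~` S j].
  by move=> i; have /choice[S SP] := sAB i; exists S.
exists (\bigcup_i \bigcap_j S i j); split.
- apply: borel_bigcup => // i _; apply: borel_bigcap => // j _.
  by case: (SP i j).
- by move=> x [i _ Ax]; exists i => // j _; case: (SP i j) => _ + _; apply.
- by move=> x [j _ Bx] [i _ /(_ j I)]; case: (SP i j) => _ _; apply.
Qed.

(** If the two sets were not separated, then neither would be some pair of their
    pieces coded by sequences with prescribed first terms; refining one term at
    a time leads to one code in each set, and these code distinct points, whose
    disjoint neighbourhoods do separate small enough pieces. *)
Theorem lusin_separation A B : hausdorff_space X ->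
  suslin A -> suslin B -> A `&` B = set0 -> borel_separated A B.
Proof.
move=> hX [F [f [clF cf imF]]] [G [g [clG cg imG]]] AB; apply: contrapT => nsep.
pose PA n a := f @` (F `&` agree n a); pose PB n b := g @` (G `&` agree n b).
pose bad n (s : (nat -> nat) * (nat -> nat)) :=
  ~ borel_separated (PA n s.1) (PB n s.2).
pose upd n (a : nat -> nat) k := fun i => if i == n then k else a i.
have split_piece h (H : set (nat -> nat)) n a : h @` (H `&` agree n a) =
    \bigcup_k (h @` (H `&` agree n.+1 (upd n a k))) :> set X.
  apply/seteqP; split=> [_ [c [Hc ac] <-]|_ [k _ [c [Hc ac] <-]]].
    exists (c n) => //; exists c => //; split=> // i.
    rewrite ltnS leq_eqVlt /upd; have [->//|_ /= ltin] := eqVneq i n.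
    exact: ac.
  exists c => //; split=> // i ltin; rewrite -ac; last exact: ltnW.
  by rewrite /upd ltn_eqF.
(* [bad n] only looks at the first [n] terms, and [step] chooses the next one. *)
have step (ns : nat * ((nat -> nat) * (nat -> nat))) :
    exists t : (nat -> nat) * (nat -> nat), bad ns.1 ns.2 ->
    [/\ agree ns.1 ns.2.1 t.1, agree ns.1 ns.2.2 t.2 & bad ns.1.+1 t].
  case: ns => n [a b] /=; have [bd|] := pselect (bad n (a, b)); last by exists (a, b).
  apply: contrapT => nt; apply: bd; rewrite /= /PA /PB !split_piece.
  apply: borel_separated_bigcup => i j; apply: contrapT => nS; apply: nt.
  exists (upd n a i, upd n b j) => _; split=> //= m ltmn;
    by rewrite /upd ltn_eqF.
have [next nextP] := choice step.
pose s := fix s n := if n is n'.+1 then next (n', s n') else (id, id).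
have bads n : bad n (s n).
  elim: n => [|n IH] /=; last by have [] := nextP (n, s n) IH.
  by rewrite /bad /PA /PB /= !agree0 !setIT imF imG.
(* Term [n] is never modified after step [n]. *)
pose a n := (s n.+1).1 n; pose b n := (s n.+1).2 n.
have agab n : agree n (s n).1 a /\ agree n (s n).2 b.
  elim: n => [|n [IHa IHb]]; first by split.
  have [/= agA agB _] := nextP (n, s n) (bads n).
  split=> i; rewrite ltnS leq_eqVlt; have [->//|_ /= ltin] := eqVneq i n.
    by rewrite -agA // IHa.
  by rewrite -agB // IHb.
have badab n : bad n (a, b).
  have [agA agB] := agab n; move=> sp; apply: (bads n).
  by rewrite /PA /PB (agree_eq agA) (agree_eq agB).
have Fa : F a.
  apply: clF => n; apply: contrapT => noF; apply: (badab n).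
  exists set0; split; [exact: borel0 | | by rewrite setC0].
  by move=> _ [c [Fc ac] <-]; apply: noF; exists c.
have Gb : G b.
  apply: clG => n; apply: contrapT => noG; apply: (badab n).
  exists setT; split; [exact: borelT | by [] |].
  by move=> _ [c [Gc bc] <-]; exfalso; apply: noG; exists c.
have : f a <> g b.
  move=> eqab; suff : (A `&` B) (f a) by rewrite AB.
  by split; [rewrite -imF; exists a | rewrite eqab -imG; exists b].
move=> /(hausdorff_separate hX)[U [V [oU oV Ux Vx UV]]].
have [n fU] := cf a Fa U (open_nbhs_nbhs (conj oU Ux)).
have [m gV] := cg b Gb V (open_nbhs_nbhs (conj oV Vx)).
apply: (badab (maxn n m)); exists U; split; first exact: borel_open.
  move=> _ [c [Fc ac] <-]; apply: fU => //.
  by apply: agree_le ac; apply: leq_maxl.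
move=> _ [c [Gc bc] <-] Ux'; suff : (U `&` V) (g c) by rewrite UV.
by split=> //; apply: gV => //; apply: agree_le bc; apply: leq_maxr.
Qed.

End SuslinOperations.

(** * Borel maps with Borel graphs *)

Lemma hausdorff_prod (X Y : topologicalType) :
  hausdorff_space X -> hausdorff_space Y -> hausdorff_space (X * Y)%type.
Proof.
move=> hX hY; rewrite open_hausdorff => -[x y] [x' y'] /eqP neq.
have [eqx|/(hausdorff_separate hX)] := pselect (x = x'); last first.
  move=> [U [V [oU oV Ux Vx UV]]]; exists (fst @^-1` U, fst @^-1` V) => /=.
    by split; apply/mem_set.
  split; [by apply: open_comp => // ? _; apply: cvg_fst | by apply: open_comp => // ? _; apply: cvg_fst |].
  by rewrite -preimage_setI UV preimage_set0.
have /(hausdorff_separate hY) : y <> y' by move=> eqy; apply: neq; rewrite eqx eqy.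
move=> [U [V [oU oV Ux Vx UV]]]; exists (snd @^-1` U, snd @^-1` V) => /=.
  by split; apply/mem_set.
split; [by apply: open_comp => // ? _; apply: cvg_snd | by apply: open_comp => // ? _; apply: cvg_snd |].
by rewrite -preimage_setI UV preimage_set0.
Qed.

Section Polish.
Context (R : realType) (Y : topologicalType) (y0 : Y).
Hypothesis polishY : polish_space R Y.

Let h (m : nat) : R := 1 / 2 ^+ m.

Lemma h_gt0 m : 0 < h m. Proof. by rewrite divr_gt0 // exprn_gt0. Qed.

Lemma h_small (e : R) : 0 < e -> exists m, h m < e.
Proof.
move=> e0; have [m _ hm] := near_infty_natSinv_expn_lt (PosNum e0).
by exists m; apply: hm => /=.
Qed.

(** The metric data in the form in which it is used: a dense sequence, and
    completeness along sequences that are Cauchy at the fixed rate [h], for which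
    no modulus of convergence has to be carried along. *)
Lemma polish_metric : exists (d : Y -> Y -> R) (q : nat -> Y),
  [/\ (forall x, d x x = 0), (forall x y, d x y = d y x),
      (forall x y z, d x z <= d x y + d y z),
      (forall x y, (forall e, 0 < e -> d x y <= e) -> x = y) &
      [/\ (forall x (A : set Y),
             nbhs x A <-> exists2 e : R, 0 < e & [set y | d x y < e] `<=` A),
          (forall u : nat -> Y,
             (forall i j, d (u i) (u j) <= h i + h j) -> exists l : Y,
               forall e, 0 < e -> exists k, forall i, (k <= i)%N -> d (u i) l <= e) &
          (forall x e, 0 < e -> exists i, d x (q i) < e)]].
Proof.
case: polishY => -[d [d0 dC dT dN dU]] [Q /countable_injP[f injf] dQ].
have dxx x : d x x = 0 by apply/d0.
have dge0 x y : 0 <= d x y.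
  by have := dT x y x; rewrite dxx (dC y x) -mulr2n pmulrn_lge0.
exists d, (fun i => xget y0 [set y | Q y /\ f y = i]); split => //.
  move=> x y small; apply/d0/eqP; rewrite eq_le dge0 andbT.
  by apply/ler_addgt0Pl => e e0; rewrite addr0; apply: small.
split=> // [u cu|x e e0].
  have [e e0|l ul] := dU u.
    have [k hk] := h_small (divr_gt0 e0 (ltr0n _ 2)).
    have hle i : (k <= i)%N -> h i <= h k.
      by move=> ki; rewrite /h ler_pM2l // lef_pV2 ?posrE ?exprn_gt0 // ler_eXn2l // ltr1n.
    exists k => i j ki kj; apply: le_lt_trans (cu i j) _.
    rewrite [e]splitr; apply: ltr_leD; first exact: le_lt_trans (hle i ki) hk.
    exact/ltW/(le_lt_trans (hle j kj) hk).
  exists l => e e0; have [|k _ kP] := ul [set y | d l y < e].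
    by apply/dN; exists e.
  by exists k => i ki; rewrite dC ltW //; apply: kP.
have [y [/interior_subset ye Qy]] : (interior [set y | d x y < e]) `&` Q !=set0.
  apply: dQ; last exact: open_interior.
  by exists x; apply/dN; exists e.
exists (f y); have [Qy' fy'] : [set z | Q z /\ f z = f y] (xget y0 [set z | Q z /\ f z = f y]).
  by apply: (xgetI y0 (x := y)).
by rewrite (injf _ _ _ _ fy') ?inE.
Qed.

Lemma polish_hausdorff : hausdorff_space Y.
Proof.
have [d [q [dxx dC dT d0 [dN _ _]]]] := polish_metric.
move=> x y cl; apply: d0 => e e0.
have e2 : 0 < e / 2 by rewrite divr_gt0.
have [||z [/= xz yz]] := cl [set z | d x z < e / 2] [set z | d y z < e / 2].
- by apply/dN; exists (e / 2).
- by apply/dN; exists (e / 2).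
by rewrite [e]splitr (le_trans (dT x z y)) // lerD ?ltW // dC.
Qed.

Lemma polish_second_countable : @second_countable Y.
Proof.
have [d [q [dxx dC dT d0 [dN _ dq]]]] := polish_metric.
exists (range (fun im : nat * nat => [set y | d (q im.1) y < h im.2])).
  by apply: sub_countable (card_image_le _ _) _; apply: countableP.
split=> [_ [[i m] _ <-]|x A /dN[e e0 eA]].
  rewrite openE => y /= yb; apply/dN; exists (h m - d (q i) y); first by rewrite subr_gt0.
  by move=> z /=; rewrite ltrBrDl; apply: le_lt_trans (dT _ _ _).
have [m hm] := h_small (divr_gt0 e0 (ltr0n _ 2)).
have [i xi] := dq x (h m) (h_gt0 m).
exists [set y | d (q i) y < h m].
  by split; [exists (i, m) | rewrite /= dC].
move=> z /= iz; apply: eA; rewrite /= [e]splitr (le_lt_trans (dT x (q i) z)) //.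
by rewrite ltrD // (lt_trans _ hm).
Qed.

(** A point is coded by a sequence of indices of points of a dense sequence
    that converges to it at a prescribed rate. *)
Lemma polish_suslin : suslin [set: Y].
Proof.
have [d [q [dxx dC dT d0 [dN dU dq]]]] := polish_metric.
pose F : set (nat -> nat) :=
  [set a | forall i j, d (q (a i)) (q (a j)) <= h i + h j].
have /choice[f fP] (a : nat -> nat) : exists l, F a ->
    forall e, 0 < e -> exists k, forall i, (k <= i)%N -> d (q (a i)) l <= e.
  by have [/dU[l lP]|nF] := pselect (F a); [exists l | exists y0].
have fh a i : F a -> d (q (a i)) (f a) <= h i.
  move=> Fa; apply/ler_addgt0Pl => e e0.
  have e2 : 0 < e / 2 by rewrite divr_gt0.
  have [k kP] := fP a Fa _ e2; have [m hm] := h_small e2.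
  pose j := maxn k m.
  apply: le_trans (dT _ (q (a j)) _) _; rewrite [e]splitr addrC -addrA lerD //.
    by apply: kP; apply: leq_maxl.
  rewrite addrC; apply: le_trans (Fa i j) _; rewrite lerD2l ltW //.
  apply: le_lt_trans hm; rewrite /h ler_pM2l // lef_pV2 ?posrE ?exprn_gt0 //.
  by rewrite ler_eXn2l ?ltr1n // leq_maxr.
exists F, f; split.
- move=> a clo i j; have [b Fb ab] := clo (maxn i j).+1.
  by rewrite !ab ?ltnS ?leq_maxl ?leq_maxr.
- move=> a Fa U /dN[e e0 eU]; have [m hm] := h_small (divr_gt0 e0 (ltr0n _ 2)).
  exists m.+1 => b Fb ab; apply: eU => /=; rewrite [e]splitr.
  apply: le_lt_trans (dT _ (q (a m)) _) _; apply: ltr_leD.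
    by rewrite dC; apply: le_lt_trans (fh a m Fa) hm.
  by rewrite ab //; apply/ltW/(le_lt_trans (fh b m Fb) hm).
- apply/seteqP; split=> // y _.
  have /choice[a aP] i := dq y (h i) (h_gt0 i).
  have Fa : F a.
    move=> i j; apply: le_trans (dT _ y _) _; rewrite lerD // ltW //.
    by rewrite dC.
  exists a => //; apply: d0 => e e0.
  have [m hm] := h_small (divr_gt0 e0 (ltr0n _ 2)).
  apply: le_trans (dT _ (q (a m)) _) _; rewrite [e]splitr lerD // ltW //.
    by rewrite dC; apply: le_lt_trans (fh a m Fa) hm.
  by rewrite dC; apply: lt_trans hm.
Qed.

(** For each ball of a countable basis, the points above which [D] meets the
    ball and those above which it meets the complement are disjoint Suslin
    sets, hence separated by a Borel set [S]; the sets [S] tell, in a Borel way,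
    towards which point of [Y] the fibre of [D] must shrink. This defines a Borel
    map on a Borel set that contains the projection of [D]; the projection is
    the set where the graph of that map is in [D], so that it is Borel too. *)
Theorem borel_fun_of_borel_graph (X : topologicalType) (D : set (X * Y)) :
  hausdorff_space X -> suslin [set: X] -> borel D ->
  (forall x y y', D (x, y) -> D (x, y') -> y = y') ->
  borel_fun (fun x => xget y0 [set y | D (x, y)]).
Proof.
move=> hX sX bD funD; have [d [q [dxx dC dT d0 [dN dU dq]]]] := polish_metric.
have hXY := hausdorff_prod hX polish_hausdorff.
have sXY : suslin [set: X * Y] by rewrite -setXTT; apply: suslin_setX polish_suslin.
(* [S j m] separates the points above the ball of centre [q j] and radius [h m]
   from those above its complement. *)
pose ball j m := [set y | d (q j) y < h m].
have openb j m : open (ball j m).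
  rewrite openE => y /= yb; apply/dN; exists (h m - d (q j) y); first by rewrite subr_gt0.
  by move=> z /=; rewrite ltrBrDl; apply: le_lt_trans (dT _ _ _).
have contsnd : continuous (@snd X Y) by move=> ?; apply: cvg_snd.
have sproj B : borel B -> suslin (fst @` (D `&` snd @^-1` B)).
  move=> bB; apply: suslin_image => [? _|]; first exact: cvg_fst.
  by apply: borel_suslin => //; apply: borelI => //; apply: borel_preimage.
have /choice[S0 S0P] (jm : nat * nat) : exists S, borel S /\
    forall x y, D (x, y) -> S x <-> ball jm.1 jm.2 y.
  have bB : borel (ball jm.1 jm.2) by apply: borel_open.
  have [|S [bS BS CS]] := lusin_separation hX (sproj _ bB) (sproj _ (borelC bB)).
    apply/seteqP; split=> // x [[[? y] [/= Dy By] <-]] [[? y'] [/= Dy' By'] eqx].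
    by apply: By'; rewrite eqx in Dy'; rewrite -(funD _ _ _ Dy Dy').
  exists S; split=> // x y Dxy; split=> [Sx|By].
    by apply: contrapT => nBy; apply: (CS x) => //; exists (x, y).
  by apply: BS; exists (x, y).
pose S j m := S0 (j, m).
have bS j m : borel (S j m) by case: (S0P (j, m)).
have SP j m x y : D (x, y) -> S j m x <-> ball j m y by case: (S0P (j, m)) => _; apply.
(* On [L] the balls selected by [S] exist at all scales and are compatible, so
   they shrink to a point; [L] is Borel, unlike, a priori, the projection of [D]. *)
pose L : set X := [set x | forall m, exists j, S j m x] `&`
  [set x | forall jm : nat * nat, forall ik : nat * nat,
     ~ (S jm.1 jm.2 `&` S ik.1 ik.2 `&`
        [set _ | ~ d (q jm.1) (q ik.1) <= h jm.2 + h ik.2]) x].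
have bL : borel L.
  apply: borelI; first by apply: borel_forall => m; apply: borel_exists => j.
  apply: borel_forall => jm; apply: borel_forall => ik; apply: borelC.
  by apply: borelI; [apply: borelI | apply: borel_cst].
have LP x j m i k : L x -> S j m x -> S i k x -> d (q j) (q i) <= h m + h k.
  by move=> [_ /(_ (j, m) (i, k)) nS] Sj Si; apply: contrapT => nd; apply: nS.
have /choice[t tP] x : exists y, L x -> forall j m, S j m x -> d (q j) y <= h m.
  have [Lx|] := pselect (L x); last by exists y0.
  have /choice[a aP] := proj1 Lx.
  have [i j|y yP] := dU (fun m => q (a m)); first exact: LP Lx (aP i) (aP j).
  exists y => _ j m Sjm; apply/ler_addgt0Pl => e e0.
  have e2 : 0 < e / 2 by rewrite divr_gt0.
  have [k kP] := yP _ e2; have [l hl] := h_small e2.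
  have kl : (k <= maxn k l)%N by apply: leq_maxl.
  apply: le_trans (dT _ (q (a (maxn k l))) _) _.
  rewrite [e]splitr addrC -addrA lerD //; first exact: kP.
  rewrite addrC; apply: le_trans (LP _ _ _ _ _ Lx Sjm (aP _)) _.
  rewrite lerD2l ltW //; apply: le_lt_trans hl.
  rewrite /h ler_pM2l // lef_pV2 ?posrE ?exprn_gt0 //.
  by rewrite ler_eXn2l ?ltr1n // leq_maxr.
pose tL x := if pselect (L x) then t x else y0.
have btL : borel_fun tL.
  apply: borel_fun_if => // U oU.
  rewrite (_ : _ `&` _ = L `&` [set x | exists jm : nat * nat,
      (S jm.1 jm.2 `&` [set _ | [set y | d (q jm.1) y <= h jm.2] `<=` U]) x]).
    apply: borelI => //; apply: borel_exists => jm.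
    by apply: borelI => //; apply: borel_cst.
  apply/seteqP; split=> x [Lx]; last first.
    by move=> [jm [Sjm jmU]]; split=> //; apply: jmU; apply: tP.
  move=> Ut; split=> //.
  have /dN[e e0 eU] := open_nbhs_nbhs (conj oU Ut).
  have [m hm] := h_small (divr_gt0 e0 (ltr0n _ 2)); have [j Sj] := proj1 Lx m.
  exists (j, m); split=> //= y /= jy; apply: eU => /=; rewrite [e]splitr.
  apply: le_lt_trans (dT _ (q j) _) _; apply: ltr_leD; last exact: le_trans jy (ltW hm).
  by rewrite dC; apply: le_lt_trans hm; apply: tP.
have tLD x y : D (x, y) -> tL x = y.
  move=> Dxy; have Lx : L x.
    split=> [m|[j m] [i k]] /=.
      have [j yj] := dq y (h m) (h_gt0 m); exists j.
      by apply: (proj2 (SP _ _ _ _ Dxy)); rewrite /ball /= dC.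
    move=> [[/(SP _ _ _ _ Dxy)/= jy /(SP _ _ _ _ Dxy)/= iy]]; apply.
    by apply: le_trans (dT _ y _) _; rewrite lerD ?ltW // dC.
  rewrite /tL; case: pselect => //= _; apply: d0 => e e0.
  have [m hm] := h_small (divr_gt0 e0 (ltr0n _ 2)); have [j Sj] := proj1 Lx m.
  apply: le_trans (dT _ (q j) _) _; rewrite [e]splitr lerD // ltW //.
    by rewrite dC; apply: le_lt_trans hm; apply: tP.
  by have /(SP _ _ _ _ Dxy)/= jy := Sj; apply: lt_trans hm.
pose A := [set x | D (x, tL x)].
have bA : borel A.
  have bpair : borel_fun (fun x => (x, tL x)).
    by apply: borel_fun_pair => //; exact: polish_second_countable.
  exact: bpair.
rewrite (_ : (fun x => _) = fun x => if pselect (A x) then tL x else y0).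
  by apply: borel_fun_if => // U oU; apply: borelI => //; apply: btL; apply: borel_open.
apply/funext => x; case: pselect => /= [Ax|nA].
  by apply: xget_unique => // y Dy; rewrite (tLD x y).
case: xgetP => // y _ Dy; exfalso; apply: nA.
by rewrite /A /= (tLD x y).
Qed.

End Polish.

(** * Linear forms and gradients on R^n *)

Lemma nbhs_distP (R : realType) (V : normedModType R) (x : V) (A : set V) :
  nbhs x A <-> exists2 r : R, 0 < r & forall y, `|y - x| < r -> A y.
Proof.
split=> [/nbhs_normP[r /= r0 rA]|[r r0 rA]].
  by exists r => // y yx; apply: rA; rewrite /= distrC.
by apply/nbhs_normP; exists r => //= y /=; rewrite distrC; apply: rA.
Qed.

Lemma open_distP (R : realType) (V : normedModType R) (U : set V) (x : V) :
  open U -> U x -> exists2 r : R, 0 < r & forall y, `|y - x| <= r -> U y.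
Proof.
move=> oU Ux; have /nbhs_distP[r r0 rU] := open_nbhs_nbhs (conj oU Ux).
exists (r / 2); first by rewrite divr_gt0.
by move=> y yx; apply: rU; apply: le_lt_trans yx _; rewrite gtr_pMr // invf_lt1 // ltr1n.
Qed.

Lemma continuous_distP (R : realType) (V W : normedModType R) (f : V -> W) (x : V) :
  {for x, continuous f} <-> (forall e : R, 0 < e -> exists2 r : R, 0 < r &
    forall y, `|y - x| < r -> `|f y - f x| <= e).
Proof.
split=> [/cvgrPdist_le cf e /cf/nbhs_distP[r r0 rP]|cf].
  by exists r => // y /rP; rewrite distrC.
apply/cvgrPdist_le => e e0; apply/nbhs_distP; have [r r0 rP] := cf e e0.
by exists r => // y /rP; rewrite distrC.
Qed.

Lemma closure_dist (R : realType) (V : normedModType R) (A : set V) (x : V) (e : R) :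
  closure A x -> 0 < e -> exists2 y, A y & `|y - x| < e.
Proof.
move=> clA e0; have [|y [Ay yx]] := clA [set y | `|y - x| < e]; last by exists y.
by apply/nbhs_distP; exists e.
Qed.

Lemma coord_le_norm (R : realType) (n : nat) (v : 'rV[R]_n) i : `|v 0 i| <= `|v|.
Proof.
by rewrite [leRHS]/Num.Def.normr /= mx_normrE; apply/bigmax_geP; right; exists (ord0, i).
Qed.

Lemma norm_le_coord (R : realType) (n : nat) (v : 'rV[R]_n) (a : R) :
  0 <= a -> (forall i, `|v 0 i| <= a) -> `|v| <= a.
Proof.
move=> a0 va; rewrite [leLHS]/Num.Def.normr /= mx_normrE; apply/bigmax_leP; split=> //.
by move=> [i j] _ /=; rewrite ord1.
Qed.

Section Dot.
Context (R : realType) (n : nat).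
Implicit Types p q u v w x y : 'rV[R]_n.

Definition dot p v : R := \sum_(i < n) p 0 i * v 0 i.

Lemma dotC p v : dot p v = dot v p.
Proof. by apply: eq_bigr => i _; rewrite mulrC. Qed.

Lemma dotDr p v w : dot p (v + w) = dot p v + dot p w.
Proof. by rewrite -big_split; apply: eq_bigr => i _; rewrite mxE mulrDr. Qed.

Lemma dotZr p (a : R) v : dot p (a *: v) = a * dot p v.
Proof. by rewrite mulr_sumr; apply: eq_bigr => i _; rewrite mxE mulrCA. Qed.

Lemma dotNr p v : dot p (- v) = - dot p v.
Proof. by rewrite -scaleN1r dotZr mulN1r. Qed.

Lemma dotBr p v w : dot p (v - w) = dot p v - dot p w.
Proof. by rewrite dotDr dotNr. Qed.

Lemma dotDl p q v : dot (p + q) v = dot p v + dot q v.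
Proof. by rewrite dotC dotDr !(dotC v). Qed.

Lemma dotZl (a : R) p v : dot (a *: p) v = a * dot p v.
Proof. by rewrite dotC dotZr dotC. Qed.

Lemma dotNl p v : dot (- p) v = - dot p v.
Proof. by rewrite dotC dotNr dotC. Qed.

Lemma dotBl p q v : dot (p - q) v = dot p v - dot q v.
Proof. by rewrite dotDl dotNl. Qed.

Lemma dot0r p : dot p 0 = 0.
Proof. by rewrite -(scale0r 0) dotZr mul0r. Qed.

Lemma dot_le p v : `|dot p v| <= n%:R * (`|p| * `|v|).
Proof.
apply: le_trans (ler_norm_sum _ _ _) _.
rewrite -[X in X%:R * _](card_ord n) mulr_natl -sumr_const.
by apply: ler_sum => i _; rewrite normrM ler_pM // coord_le_norm.
Qed.

Lemma dot_eq0 p : (forall v, dot p v = 0) -> p = 0.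
Proof.
move=> p0; apply/rowP => i; rewrite mxE -(p0 (delta_mx 0 i)) /dot (bigD1 i) //=.
rewrite big1 ?addr0 => [|j ji]; first by rewrite !mxE !eqxx mulr1.
by rewrite mxE (negPf ji) andbF mulr0.
Qed.

Lemma dot_self_ge p : `|p| ^+ 2 <= dot p p.
Proof.
have sq i : 0 <= p 0 i * p 0 i by rewrite -expr2 sqr_ge0.
rewrite -[X in X ^+ 2]sqr_sqrtr ?normr_ge0 // -exprM.
suff H : `|p| <= Num.sqrt (dot p p).
  rewrite exprM sqr_sqrtr // -[leRHS]sqr_sqrtr ?sumr_ge0 //.
  by rewrite ler_sqr ?nnegrE ?sqrtr_ge0.
apply: norm_le_coord => [|i]; first exact: sqrtr_ge0.
rewrite -sqrtr_sqr ler_sqrt ?sumr_ge0 // /dot (bigD1 i) //= -expr2 lerDl.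
by rewrite sumr_ge0.
Qed.

Lemma dot_linear p : linear_for *%R (dot p).
Proof. by move=> a u v; rewrite dotDr dotZr. Qed.

Definition dot_fun p : 'rV[R]_n -> R^o := dot p.

HB.instance Definition _ p :=
  GRing.isLinear.Build R 'rV[R]_n R^o *:%R (dot_fun p) (dot_linear p).

Lemma linear_dot (l : {linear 'rV[R]_n -> R^o}) : exists p, forall v, l v = dot p v.
Proof.
exists (\row_i l (delta_mx 0 i)) => v.
rewrite {1}(row_sum_delta v) linear_sum; apply: eq_bigr => i _.
by rewrite linearZ mxE /= mulrC.
Qed.

Definition has_gradient (f : 'rV[R]_n -> R) x p : Prop :=
  forall e : R, 0 < e -> exists2 r : R, 0 < r & forall y, `|y - x| < r ->
    `|f y - f x - dot p (y - x)| <= e * `|y - x|.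

Lemma dot_continuous p : continuous (dot_fun p).
Proof.
move=> x; apply/continuous_distP => e e0.
have K0 : 0 < n%:R * `|p| + 1 by rewrite ltr_wpDl // mulr_ge0.
exists (e / (n%:R * `|p| + 1)); first by rewrite divr_gt0.
move=> y yx; rewrite -linearB; apply: le_trans (dot_le _ _) _; rewrite mulrA.
move: yx; rewrite ltr_pdivlMr // => /ltW; apply: le_trans.
by rewrite mulrC ler_wpM2l // lerDl.
Qed.

Lemma has_gradient_differentiable (f : 'rV[R]_n -> R) x p :
  has_gradient f x p ->
  differentiable (f : 'rV[R]_n -> R^o) x /\
  forall v, 'd (f : 'rV[R]_n -> R^o) x v = dot p v.
Proof.
move=> fp; have fo : (f : _ -> R^o) \o shift x =
    cst (f x : R^o) + dot_fun p +o_ (0 : 'rV[R]_n) id.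
  apply/eqaddoP => e e0; have [r r0 rP] := fp e e0.
  apply/nbhs_distP; exists r => // y; rewrite subr0 => yr /=.
  by have := rP (y + x); rewrite addrK => /(_ yr); rewrite opprD addrA.
have dfp := diff_unique (@dot_continuous p) fo.
by split=> [|v]; [apply/diff_locallyP; rewrite dfp; split=> //; exact: dot_continuous
                 | rewrite dfp].
Qed.

Lemma differentiable_has_gradient (f : 'rV[R]_n -> R) x p :
  differentiable (f : 'rV[R]_n -> R^o) x ->
  (forall v, 'd (f : 'rV[R]_n -> R^o) x v = dot p v) -> has_gradient f x p.
Proof.
move=> /diff_locallyP[_ /eqaddoP fo] dfp e /fo/nbhs_distP[r r0 rP].
exists r => // y yx; have := rP (y - x); rewrite subr0 => /(_ yx) /=.
by rewrite !fctE /= subrK dfp opprD addrA.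
Qed.

Lemma differentiableP_gradient (f : 'rV[R]_n -> R) x :
  differentiable (f : 'rV[R]_n -> R^o) x <-> exists p, has_gradient f x p.
Proof.
split=> [df|[p /has_gradient_differentiable[]//]].
have [p dfp] := linear_dot ('d (f : 'rV[R]_n -> R^o) x).
by exists p; apply: differentiable_has_gradient.
Qed.

(** Two linear forms that compare up to a small multiple of the norm near 0 are
    equal, since a linear form is determined by its values near 0 up to scaling
    and both signs are available. *)
Lemma dot_le_eq p q :
  (forall e : R, 0 < e -> exists2 r : R, 0 < r & forall v, `|v| < r ->
     dot p v <= dot q v + e * `|v|) -> p = q.
Proof.
move=> pq; apply/eqP; rewrite -subr_eq0; apply/eqP/dot_eq0.
suff H v : dot (p - q) v <= 0.
  by move=> v; apply/eqP; rewrite eq_le H /= -oppr_le0 -dotNr H.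
apply/ler_addgt0Pl => e e0; rewrite addr0.
have v1 : 0 < `|v| + 1 by rewrite ltr_wpDl.
have [r r0 rP] := pq (e / (`|v| + 1)) (divr_gt0 e0 v1).
have a0 : 0 < r / (`|v| + 1) by rewrite divr_gt0.
have := rP ((r / (`|v| + 1)) *: v); rewrite normrZ (gtr0_norm a0) !dotZr.
have -> : r / (`|v| + 1) * `|v| < r.
  by rewrite mulrAC ltr_pdivrMr // ltr_pM2l // ltrDl.
move=> /(_ isT); rewrite mulrCA -mulrDr ler_pM2l // dotBl lerBlDl => /le_trans.
apply; rewrite lerD2l mulrAC ler_pdivrMr // ler_pM2l // lerDl.
by [].
Qed.

Lemma has_gradient_unique (f : 'rV[R]_n -> R) x p q :
  has_gradient f x p -> has_gradient f x q -> p = q.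
Proof.
move=> fp fq; apply: dot_le_eq => e e0.
have e2 : 0 < e / 2 by rewrite divr_gt0.
have [r r0 rP] := fp _ e2; have [s s0 sP] := fq _ e2.
exists (Num.min r s) => [|v]; first by rewrite lt_min r0.
rewrite lt_min => /andP[vr vs].
have := rP (v + x); have := sP (v + x); rewrite addrK => /(_ vs) + /(_ vr).
by rewrite !ler_norml => /andP[? ?] /andP[? ?]; lra.
Qed.

End Dot.

(** * Semi-concave functions on R^n *)

Lemma modulus_small (R : realType) (w : R -> R) (e : R) : modulus w ->
  0 < e -> exists2 r, 0 < r & forall s, 0 <= s -> s <= r -> w s <= e.
Proof.
move=> [cw _ wge0 w0] e0; have /subspace_continuousP/(_ 0 (lexx 0)) := cw.
move=> /cvgrPdist_le/(_ e e0)/nbhs_distP[r r0 rP].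
exists (r / 2) => [|s s0 sr]; first by rewrite divr_gt0.
have := rP s; rewrite subr0 ger0_norm //= => /(_ _ s0).
rewrite /from_subspace w0 sub0r normrN ger0_norm ?wge0 //; apply.
by apply: le_lt_trans sr _; rewrite gtr_pMr // invf_lt1 // ltr1n.
Qed.

Section Semiconcave.
Context (R : realType) (n : nat).
Implicit Types (p q x y z : 'rV[R]_n) (U : set 'rV[R]_n) (f : 'rV[R]_n -> R).
Implicit Types w : R -> R.

Definition supergradient w U f x p : Prop :=
  forall y, U y -> f y - f x <= dot p (y - x) + `|y - x| * w `|y - x|.

Lemma semiconcaveP w U f :
  semiconcave w U f <-> forall x, U x -> exists p, supergradient w U f x p.
Proof.
split=> sc x Ux.
  have [l lP] := sc x Ux; have [p lp] := linear_dot l.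
  by exists p => y Uy; rewrite -lp; apply: lP.
by have [p pP] := sc x Ux; exists (dot_fun p).
Qed.

Definition corner x (r : R) (s : {ffun 'I_n -> bool}) : 'rV[R]_n :=
  x + \row_i (if s i then r else - r).

Lemma corner_dist x r s : 0 <= r -> `|corner x r s - x| <= r.
Proof.
move=> r0; apply: norm_le_coord => // i; rewrite addrC addKr mxE.
by case: (s i); rewrite ?normrN ger0_norm.
Qed.

(** Moving from a point near the centre of a cube to the corner opposite to the
    signs of [p] makes [dot p] decrease by an amount comparable to [p]. *)
Lemma corner_descent p x y (r : R) : 0 < r -> `|y - x| <= r / 2 ->
  exists s, dot p (corner x r s - y) <= - (r / 2 * `|p|).
Proof.
move=> r0 yx; exists [ffun i => p 0 i <= 0].
set v := corner _ _ _ - y.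
have vE i : v 0 i = (if p 0 i <= 0 then r else - r) - (y - x) 0 i.
  by rewrite !mxE ffunE; ring.
have term i : p 0 i * v 0 i <= - (r / 2 * `|p 0 i|).
  have : `|(y - x) 0 i| <= r / 2 by apply: le_trans yx; apply: coord_le_norm.
  rewrite ler_norml vE; move: (p 0 i) ((y - x) 0 i) => a b /andP[lo hi].
  by case: (leP a 0) => a0; [rewrite ler0_norm | rewrite gtr0_norm]; nra.
apply: (@le_trans _ _ (\sum_i - (r / 2 * `|p 0 i|))); first exact: ler_sum.
rewrite sumrN lerN2 -mulr_sumr ler_pM2l ?divr_gt0 //.
apply: norm_le_coord => [|i]; first exact: sumr_ge0.
by rewrite (bigD1 i) //= lerDl sumr_ge0.
Qed.

(** Supergradients of a function are controlled by an upper bound of the function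
    at the point and a lower bound at the corners of a surrounding cube: by
    [corner_descent] a large supergradient would push the value at a corner
    down. *)
Lemma supergradient_bound w U f x (r m C : R) : modulus w -> 0 < r ->
  (forall y, `|y - x| <= r -> U y) -> (forall s, m <= f (corner x r s)) ->
  forall y p, `|y - x| <= r / 2 -> f y <= C -> supergradient w U f y p ->
  `|p| <= 2 / r * (C - m + 2 * r * w (2 * r)).
Proof.
move=> [_ wmono wge0 _] r0 xU fm y p yx fyC yp.
have [s sP] := corner_descent p r0 yx.
have cx := corner_dist x s (ltW r0).
have cy : `|corner x r s - y| <= 2 * r.
  rewrite -(subrKA x) (le_trans (ler_normD _ _)) // (distrC x y).
  by rewrite mulr_natl mulr2n lerD // (le_trans yx) // ler_pdivrMr // ler_pMr // ler1n.
have := yp _ (xU _ cx); rewrite lerBlDr => /(le_trans (fm s)) fm'.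
have : `|corner x r s - y| * w `|corner x r s - y| <= 2 * r * w (2 * r).
  by rewrite ler_pM // ?wge0 // wmono.
move: sP fm'; set D := dot _ _; set W := _ * w `|_|; set W' := 2 * r * _.
move=> sP fm' WW'; have key : r / 2 * `|p| <= C - m + W' by lra.
have -> : `|p| = 2 / r * (r / 2 * `|p|) by field; rewrite gt_eqF.
by rewrite ler_pM2l // divr_gt0.
Qed.

(** The bound of [supergradient_bound] for a single function; semi-concavity at
    the centre of the cube bounds the function from above. *)
Lemma supergradient_locally_bounded w U f x : modulus w -> open U -> U x ->
  (forall y, U y -> exists p, supergradient w U f y p) ->
  exists B r : R, [/\ 0 < r, (forall y, `|y - x| <= r -> U y) &
    forall y p, `|y - x| <= r -> supergradient w U f y p -> `|p| <= B].
Proof.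
move=> mw oU Ux sc; have [r r0 rU] := open_distP oU Ux.
have [q qx] := sc x Ux; case: (mw) => _ wmono wge0 _.
pose m := \big[Order.min/f x]_(s : {ffun 'I_n -> bool}) f (corner x r s).
pose C := f x + (n%:R * (`|q| * r) + r * w r).
have r2 : r / 2 <= r by lra.
exists (2 / r * (C - m + 2 * r * w (2 * r))), (r / 2); split.
- by rewrite divr_gt0.
- by move=> y yx; apply: rU; apply: le_trans yx r2.
move=> y p yx; apply: (supergradient_bound mw r0 rU) => // [s|].
  exact: bigmin_le.
have yr : `|y - x| <= r by apply: le_trans yx r2.
rewrite /C -lerBlDl; apply: le_trans (qx y (rU y yr)) _; apply: lerD.
  apply: le_trans (ler_norm _) _; apply: le_trans (dot_le _ _) _.
  by rewrite ler_wpM2l // ler_wpM2l.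
by rewrite ler_pM // ?wge0 // wmono.
Qed.

Lemma semiconcave_lipschitz_at w U f x : modulus w -> open U -> U x ->
  semiconcave w U f ->
  exists K r : R, [/\ 0 < K, 0 < r, (forall y, `|y - x| <= r -> U y) &
    forall y, `|y - x| <= r -> `|f y - f x| <= K * `|y - x|].
Proof.
move=> mw oU Ux /semiconcaveP sc.
have [B [r [r0 rU BP]]] := supergradient_locally_bounded mw oU Ux sc.
case: (mw) => _ wmono wge0 _.
have B0 : 0 <= B.
  have [p px] := sc x Ux; apply: le_trans (BP x p _ px) => //.
  by rewrite subrr normr0 ltW.
exists (n%:R * B + w r + 1), r; split=> // [|y yx].
  by have := wge0 r (ltW r0); have : 0 <= n%:R * B := mulr_ge0 (ler0n _ _) B0; lra.
have wyx : `|y - x| * w `|y - x| <= w r * `|y - x|.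
  by rewrite mulrC ler_wpM2r // wmono.
have dotB p : `|p| <= B -> `|dot p (y - x)| <= n%:R * B * `|y - x|.
  by move=> pB; apply: le_trans (dot_le _ _) _; rewrite -mulrA ler_wpM2l // ler_wpM2r.
have yx0 := normr_ge0 (y - x).
have [p px] := sc x Ux; have [q qy] := sc y (rU y yx).
have pB : `|p| <= B by apply: BP px; rewrite subrr normr0 ltW.
have := px y (rU y yx); have := qy x Ux; rewrite (distrC x y) -[x - y]opprB dotNr.
have := dotB p pB; have := dotB q (BP _ _ yx qy); rewrite !ler_norml.
move=> /andP[? ?] /andP[? ?] ? ?; rewrite !mulrDl mul1r; apply/andP; split; lra.
Qed.

Lemma semiconcave_continuous w U f x : modulus w -> open U -> U x ->
  semiconcave w U f -> {for x, continuous f}.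
Proof.
move=> mw oU Ux sc; have [K [r [K0 r0 _ KP]]] := semiconcave_lipschitz_at mw oU Ux sc.
apply/continuous_distP => e e0; exists (Num.min r (e / K)).
  by rewrite lt_min r0 divr_gt0.
move=> y; rewrite lt_min => /andP[yr yK]; apply: le_trans (KP y (ltW yr)) _.
by rewrite mulrC -ler_pdivlMr // ltW.
Qed.

(** Compactness of balls, in the form that extracts a limit from approximate
    solutions of a problem. *)
Lemma cluster_point (Q : R -> 'rV[R]_n -> Prop) (B : R) :
  (forall d d' p, d <= d' -> Q d p -> Q d' p) ->
  (forall d, 0 < d -> exists2 p, `|p| <= B & Q d p) ->
  exists2 p, `|p| <= B & forall d, 0 < d -> exists2 q, Q d q & `|q| <= B /\ `|q - p| < d.
Proof.
move=> Qmono Qex; pose A := [set p : 'rV[R]_n | `|p| <= B].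
have cA : compact A.
  apply: bounded_closed_compact; last first.
    rewrite (_ : A = closed_ball_ Num.Def.normr 0 B); first exact: closed_closed_ball_.
    by apply/seteqP; split=> p; rewrite /A /closed_ball_ /= sub0r normrN.
  by exists B; split; [exact: num_real | move=> M BM p pB; apply: le_trans pB (ltW BM)].
pose F := filter_from [set d : R | 0 < d] (fun d => A `&` Q d).
have FF : ProperFilter F.
  apply: filter_from_proper => [|d d0]; last by have [p] := Qex d d0; exists p.
  apply: filter_from_filter; first by exists 1 => /=.
  move=> d d' d0 d'0; exists (Num.min d d'); first by rewrite /= lt_min d0.
  by move=> p [Ap Qp]; split; split=> //; apply: Qmono Qp; rewrite ge_min lexx ?orbT.
have [|p [Ap clp]] := cA F FF; first by exists 1 => //= p [].
exists p => // d d0.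
have [||q [[Aq Qq] qp]] := clp (A `&` Q d) [set q | `|q - p| < d].
- by exists d.
- by apply/nbhs_distP; exists d.
by exists q.
Qed.

(** A cluster point of supergradients of members of the family that nearly realize
    the infimum at a point is a supergradient of the infimum there. *)
Lemma semiconcave_inf (I : Type) (D : set I) (g : I -> 'rV[R]_n -> R) w U f :
  modulus w -> open U -> (forall i, D i -> semiconcave w U (g i)) ->
  (forall x, U x -> (forall i, D i -> f x <= g i x) /\
     forall e, 0 < e -> exists2 i, D i & g i x < f x + e) ->
  semiconcave w U f.
Proof.
move=> mw oU scg fP; apply/semiconcaveP => x Ux.
have [r r0 rU] := open_distP oU Ux; case: (mw) => _ wmono wge0 _.
pose m := \big[Order.min/f x]_(s : {ffun 'I_n -> bool}) f (corner x r s).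
pose Q (d : R) p := exists2 i, D i & g i x < f x + d /\
  (g i x < f x + 1 /\ supergradient w U (g i) x p).
have [|d d0|p _ pP] := @cluster_point Q (2 / r * (f x + 1 - m + 2 * r * w (2 * r))).
- move=> d d' p dd' [i Di [gi [gi1 ip]]]; exists i => //; split=> //.
  by apply: lt_le_trans gi _; rewrite lerD2l.
- have d1 : 0 < Num.min d 1 by rewrite lt_min d0 ltr01.
  have [i Di] := proj2 (fP x Ux) _ d1; rewrite -ltrBlDl lt_min !ltrBlDl => /andP[gid gi1].
  have [p ip] := proj1 (semiconcaveP _ _ _) (scg i Di) x Ux.
  exists p; last by exists i.
  apply: (supergradient_bound mw r0 rU _ _ (ltW gi1) ip).
    move=> s; apply: le_trans (proj1 (fP _ (rU _ (corner_dist x s (ltW r0)))) i Di).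
    exact: bigmin_le.
  by rewrite subrr normr0 ltW // divr_gt0.
exists p => y Uy; apply/ler_addgt0Pl => e e0.
pose K := n%:R * `|y - x| + 1.
have K0 : 0 < K by rewrite ltr_wpDl // mulr_ge0.
have [q [i Di [gi [_ iq]]] [_ qp]] := pP (e / K) (divr_gt0 e0 K0).
have := iq y Uy; have := proj1 (fP y Uy) i Di.
have : dot q (y - x) <= dot p (y - x) + n%:R * (e / K * `|y - x|).
  rewrite -lerBlDl -dotBl; apply: le_trans (ler_norm _) _.
  by apply: le_trans (dot_le _ _) _; rewrite ler_wpM2l // ler_wpM2r // ltW.
have : n%:R * (e / K * `|y - x|) + e / K = e.
  by rewrite /K; field; rewrite gt_eqF.
by set W := _ * w _; move=> ? ? ? ?; lra.
Qed.

Lemma semiconcave_sub w U V f : V `<=` U -> semiconcave w U f -> semiconcave w V f.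
Proof.
move=> VU sc x /VU Ux; have [l lP] := sc x Ux.
by exists l => y /VU; apply: lP.
Qed.

End Semiconcave.

Section Differentiability.
Context (R : realType) (n : nat).
Implicit Types (p q x y z : 'rV[R]_n) (U : set 'rV[R]_n) (f : 'rV[R]_n -> R).
Implicit Types w : R -> R.

(** The first-order upper bound given by a supergradient of a semi-concave
    function, forgetting the modulus and the domain; this form is local. *)
Definition near_supergradient f x p : Prop :=
  forall e : R, 0 < e -> exists2 r : R, 0 < r & forall y, `|y - x| < r ->
    f y - f x <= dot p (y - x) + e * `|y - x|.

Lemma supergradient_near w U f x p : modulus w -> open U -> U x ->
  supergradient w U f x p -> near_supergradient f x p.
Proof.
move=> mw oU Ux px e e0; have [r r0 rU] := open_distP oU Ux.
have [s s0 sw] := modulus_small mw e0.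
exists (Num.min r s) => [|y]; first by rewrite lt_min r0.
rewrite lt_min => /andP[yr ys]; apply: le_trans (px y (rU y (ltW yr))) _.
by rewrite lerD2l mulrC ler_wpM2r // sw // ltW.
Qed.

Lemma has_gradient_near f x p : has_gradient f x p -> near_supergradient f x p.
Proof.
move=> fp e /fp[r r0 rP]; exists r => // y /rP; rewrite ler_norml => /andP[_].
by rewrite lerBlDl.
Qed.

Lemma has_gradientP f x p : has_gradient f x p <->
  near_supergradient f x p /\ near_supergradient (fun y => - f y) x (- p).
Proof.
split=> [fp|[fp Nfp] e e0].
  split; first exact: has_gradient_near.
  move=> e /fp[r r0 rP]; exists r => // y /rP; rewrite ler_norml => /andP[+ _].
  by rewrite dotNl; lra.
have [r r0 rP] := fp e e0; have [s s0 sP] := Nfp e e0.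
exists (Num.min r s) => [|y]; first by rewrite lt_min r0.
rewrite lt_min => /andP[/rP fr /sP]; rewrite dotNl ler_norml => fs.
by apply/andP; split; lra.
Qed.

(** A function with a supergradient that stays above a differentiable one with
    equality at a point is differentiable there, with the same gradient: it is
    squeezed between two linear forms, which must be equal. *)
Lemma has_gradient_squeeze f g x p q (r : R) : 0 < r ->
  (forall y, `|y - x| < r -> g y - g x <= f y - f x) ->
  has_gradient g x q -> near_supergradient f x p -> has_gradient f x q.
Proof.
move=> r0 gf /has_gradientP[_ gq] fp.
have Nfq : near_supergradient (fun y => - f y) x (- q).
  move=> e /gq[s s0 sP]; exists (Num.min r s) => [|y]; first by rewrite lt_min r0.
  by rewrite lt_min => /andP[/gf ? /sP]; lra.
suff eqqp : q = p by apply/has_gradientP; rewrite {1}eqqp.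
apply: dot_le_eq => e e0; have e2 : 0 < e / 2 by rewrite divr_gt0.
have [s s0 sP] := fp _ e2; have [t t0 tP] := Nfq _ e2.
exists (Num.min s t) => [|v]; first by rewrite lt_min s0.
rewrite lt_min => /andP[vs vt].
have := sP (v + x); have := tP (v + x).
by rewrite addrK dotNl => /(_ vt) + /(_ vs); lra.
Qed.

Lemma has_gradientN f x p : has_gradient f x p ->
  has_gradient (fun y => - f y) x (- p).
Proof.
move=> fp e /fp[r r0 rP]; exists r => // y /rP; rewrite dotNl.
by rewrite !ler_norml => /andP[? ?]; apply/andP; split; lra.
Qed.

Lemma has_gradientD f g x p q : has_gradient f x p -> has_gradient g x q ->
  has_gradient (fun y => f y + g y) x (p + q).
Proof.
move=> fp gq e e0; have e2 : 0 < e / 2 by rewrite divr_gt0.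
have [r r0 rP] := fp _ e2; have [s s0 sP] := gq _ e2.
exists (Num.min r s) => [|y]; first by rewrite lt_min r0.
rewrite lt_min => /andP[/rP fr /sP]; move: fr.
rewrite !ler_norml dotDl => /andP[? ?] /andP[? ?]; apply/andP; split; lra.
Qed.

(** The difference of the two functions has a minimum at [x]. *)
Lemma has_gradient_touch f g x p q (r : R) : 0 < r -> f x = g x ->
  (forall y, `|y - x| < r -> f y <= g y) ->
  has_gradient f x p -> has_gradient g x q -> p = q.
Proof.
move=> r0 fgx fg fp gq; apply: (has_gradient_unique _ gq).
apply: (has_gradient_squeeze r0 _ fp (has_gradient_near gq)) => y /fg.
by rewrite fgx; lra.
Qed.

(** Differentiability as a smallness condition on symmetric second differences:
    the supergradient bounds the increments in opposite directions from above,
    and the second difference turns each bound into one from below for the other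
    direction. It has no quantifier over linear forms, and it only involves
    values of the function at countably many translates. *)
Lemma near_supergradient_differentiable f x p : near_supergradient f x p ->
  (exists q, has_gradient f x q) <->
  (forall e : R, 0 < e -> exists2 r : R, 0 < r & forall h, `|h| < r ->
     - (e * `|h|) <= f (x + h) + f (x - h) - 2 * f x).
Proof.
move=> fp; split=> [[q fq] e e0|sym].
  have e2 : 0 < e / 2 by rewrite divr_gt0.
  have [r r0 rP] := fq _ e2; exists r => // h hr.
  have := rP (x + h); have := rP (x - h); rewrite ![x + _]addrC !addrK normrN dotNr.
  move=> /(_ hr) + /(_ hr); rewrite !ler_norml => /andP[? ?] /andP[? ?]; lra.
exists p; apply/has_gradientP; split=> // e e0.
have e2 : 0 < e / 2 by rewrite divr_gt0.
have [r r0 rP] := fp _ e2; have [s s0 sP] := sym _ e2.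
exists (Num.min r s) => [|y]; first by rewrite lt_min r0.
rewrite lt_min => /andP[yr ys]; have := sP (y - x) ys.
have := rP (x - (y - x)); rewrite [x - _]addrC addrK normrN !dotNr dotNl => /(_ yr).
by rewrite [x + _]addrC subrK; lra.
Qed.

(** At a point of non-differentiability of a semi-concave function the
    supergradients at nearby points do not all tend to a given one at the point,
    and they accumulate at another. *)
Lemma two_supergradients w U f x : modulus w -> open U -> U x ->
  semiconcave w U f -> ~ (exists q, has_gradient f x q) ->
  exists p q, [/\ p != q, near_supergradient f x p & near_supergradient f x q].
Proof.
move=> mw oU Ux scf ndiff; have sc := proj1 (semiconcaveP _ _ _) scf.
have [B [r [r0 rU BP]]] := supergradient_locally_bounded mw oU Ux sc.
have [K [r' [K0 r'0 _ KP]]] := semiconcave_lipschitz_at mw oU Ux scf.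
have [p px] := sc x Ux; have pnear := supergradient_near mw oU Ux px.
(* The upper bound always holds, so differentiability with gradient [p] can only
   fail through the lower bound. *)
have [e e0 farP] : exists2 e : R, 0 < e & forall d, 0 < d ->
    exists y, `|y - x| < d /\ f y - f x < dot p (y - x) - e * `|y - x|.
  apply: contrapT => nfar; apply: ndiff; exists p; apply/has_gradientP; split=> // e e0.
  apply: contrapT => nr; apply: nfar; exists e => // d d0.
  apply: contrapT => ny; apply: nr; exists d => // y yd; apply: contrapT => nle.
  apply: ny; exists y; split=> //; move/negP: nle; rewrite -ltNge dotNl; lra.
have e2 : 0 < e / 2 by rewrite divr_gt0.
have [t t0 tw] := modulus_small mw e2.
(* The lower bound at [x] fails at points [y] tending to [x]; comparing with the
   bound at [y] keeps the supergradients at [y] away from [p]. *)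
pose Q (d : R) q := exists y, [/\ `|y - x| < d, `|y - x| <= r, `|y - x| <= r',
  supergradient w U f y q & e / 2 <= n%:R * `|p - q|].
have [|d d0|q qB qP] := @cluster_point R n Q B.
- move=> d d' q dd' [y [yd yr yr' yq pq]]; exists y; split=> //.
  exact: lt_le_trans dd'.
- have m0 : 0 < Num.min (Num.min d t) (Num.min r r') by rewrite !lt_min d0 t0 r0.
  have [y [+ fy]] := farP _ m0; rewrite !lt_min => /andP[/andP[yd yt] /andP[yr yr']].
  have [q yq] := sc y (rU y (ltW yr)); exists q; first exact: BP (ltW yr) yq.
  exists y; split=> //; try exact: ltW.
  have := yq x Ux; rewrite (distrC x y) -[x - y]opprB dotNr => fxy.
  have := tw _ (normr_ge0 _) (ltW yt) => wyx.
  have yx0 : 0 < `|y - x|.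
    rewrite normr_gt0; apply/eqP => yx0; move: fy.
    by rewrite yx0 dot0r normr0 mulr0 (subr0_eq yx0) !subrr ltxx.
  have wyx' : `|y - x| * w `|y - x| <= e / 2 * `|y - x| by rewrite mulrC ler_wpM2r // ltW.
  have pq := le_trans (ler_norm _) (dot_le (p - q) (y - x)).
  rewrite -(ler_pM2r yx0) -[n%:R * _ * _]mulrA; apply: le_trans pq.
  by rewrite dotBl; move: wyx' fxy fy; set W := _ * w _; lra.
exists p, q; split=> //.
  apply/eqP => pq; have n1 : 0 < n%:R + 1 :> R by rewrite ltr_wpDl.
  have [q' [y [_ _ _ _ pq']] [_ qq']] := qP (e / 2 / (n%:R + 1)) (divr_gt0 e2 n1).
  have : n%:R * `|p - q'| <= n%:R * (e / 2 / (n%:R + 1)).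
    by rewrite ler_wpM2l // pq distrC ltW.
  have -> : n%:R * (e / 2 / (n%:R + 1)) = e / 2 - e / 2 / (n%:R + 1).
    by field; rewrite gt_eqF.
  by have := divr_gt0 e2 n1; lra.
move=> eta eta0; have [s s0 sw] := modulus_small mw eta0.
have s2 : 0 < s / 2 by rewrite divr_gt0.
exists (Num.min (s / 2) r) => [|z]; first by rewrite lt_min s2.
rewrite lt_min => /andP[zs zr]; apply/ler_addgt0Pl => e' e'0.
pose L := n%:R * `|z - x| + n%:R * B + eta + K.
have B0 : 0 <= B by apply: le_trans qB.
have L0 : 0 < L.
  have := mulr_ge0 (ler0n R n) B0; have := mulr_ge0 (ler0n R n) (normr_ge0 (z - x)).
  by rewrite /L; lra.
pose d := Num.min (e' / L) (s / 2).
have d0 : 0 < d by rewrite lt_min divr_gt0.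
have [q' [y [yd yr yr' yq' _]] [q'B q'q]] := qP d d0.
have /andP[dL ds] : (d <= e' / L) && (d <= s / 2) by rewrite /d !ge_min !lexx orbT.
have Uz := rU z (ltW zr).
have zy : `|z - y| <= `|z - x| + d.
  by rewrite -(subrKA x) (le_trans (ler_normD _ _)) // lerD2l distrC ltW.
have := yq' z Uz => fzy.
have wzy : `|z - y| * w `|z - y| <= eta * (`|z - x| + d).
  rewrite mulrC; apply: ler_pM => //; last first.
    by apply: sw => //; apply: le_trans zy _; rewrite [s]splitr lerD // ltW.
  by case: mw => _ _ + _; apply.
have fyx : f y - f x <= K * d.
  apply: le_trans (ler_norm _) _; apply: le_trans (KP y yr') _.
  by rewrite ler_pM2l // ltW.
have dot1 : dot (q' - q) (z - x) <= n%:R * (d * `|z - x|).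
  apply: le_trans (ler_norm _) _; apply: le_trans (dot_le _ _) _.
  by rewrite ler_wpM2l // ler_wpM2r // ltW.
have dot2 : dot q' (x - y) <= n%:R * (B * d).
  apply: le_trans (ler_norm _) _; apply: le_trans (dot_le _ _) _.
  by rewrite ler_wpM2l // ler_pM // distrC ltW.
have dL' : d * L <= e' by rewrite -ler_pdivlMr.
have dsplit : dot q' (z - y) = dot q (z - x) + dot (q' - q) (z - x) + dot q' (x - y).
  by rewrite !dotBr !dotBl; ring.
rewrite dsplit in fzy; move: fzy wzy dot1 dot2 dL' fyx; rewrite /L.
set W := _ * w _; set a := dot _ _; set b := dot _ _; set c := dot _ _.
by move=> *; nra.
Qed.

End Differentiability.

(** * Sets of non-differentiability are countably Lipschitz *)

Section LipschitzGraphs.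
Context (R : realType) (n : nat).
Implicit Types (p q u v x y z : 'rV[R]_n) (K : set 'rV[R]_n).

Definition ratv (r : 'rV[rat]_n) : 'rV[R]_n := map_mx ratr r.

Lemma ratv_dense v (e : R) : 0 < e -> exists r : 'rV[rat]_n, `|ratv r - v| < e.
Proof.
move=> e0; have /choice[r rP] : forall i, exists r : rat, `|ratr r - v 0 i| < e / 2.
  move=> i; have [|r] := @rat_in_itvoo R (v 0 i - e / 2) (v 0 i + e / 2).
    by rewrite ltrBlDr -addrA -splitr ltrDl.
  by rewrite in_itv /= => /andP[? ?]; exists r; rewrite ltr_norml; apply/andP; split; lra.
exists (\row_i r i); apply: (@le_lt_trans _ _ (e / 2)); last lra.
apply: norm_le_coord => [|i]; first lra.
by rewrite !mxE ltW.
Qed.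

Lemma dot_self_gt0 u : u != 0 -> 0 < dot u u.
Proof.
by move=> u0; apply: lt_le_trans (dot_self_ge u); rewrite exprn_gt0 // normr_gt0.
Qed.

Lemma dim_ker_dot u : u != 0 -> hyperplane (lker (linfun (dot_fun u))).
Proof.
move=> u0; rewrite /hyperplane.
have := limg_ker_dim (linfun (dot_fun u)) fullv.
rewrite capfv dimvf [dim _]mul1n => dimn; apply: etrans dimn.
rewrite -addn1; congr (_ + _)%N.
apply/eqP; rewrite eqn_leq; apply/andP; split.
  rewrite lt0n dimv_eq0; apply/negP => /eqP im0.
  have := memv_img (linfun (dot_fun u)) (memvf u); rewrite im0 memv0 lfunE /=.
  by rewrite /dot_fun gt_eqF // dot_self_gt0.
by apply: leq_trans (dimvS (subvf _)) _; rewrite dimvf.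
Qed.

(** When differences of points of [K] are nearly orthogonal to [u], projecting [K]
    along [u] at most halves distances, so [K] is a Lipschitz graph over its
    projection. *)
Lemma lipschitz_graph_orthogonal K u : u != 0 -> compact K ->
  (forall x y, K x -> K y -> `|dot u (x - y)| <= `|u| / 2 * `|x - y|) ->
  in_lipschitz_graph K.
Proof.
move=> u0 cK Ku; have uu0 := dot_self_gt0 u0.
pose s x := dot u x / dot u u; pose proj x := x - s x *: u.
have sB x y : s (x - y) = s x - s y by rewrite /s dotBr mulrBl.
have s_le x y : K x -> K y -> `|(s x - s y) *: u| <= 2^-1 * `|x - y|.
  move=> Kx Ky; rewrite -sB normrZ /s normrM normfV (gtr0_norm uu0).
  rewrite mulrAC ler_pdivrMr //.
  apply: (@le_trans _ _ (`|u| / 2 * `|x - y| * `|u|)); first by rewrite ler_wpM2r // Ku.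
  rewrite [leLHS](_ : _ = 2^-1 * `|x - y| * `|u| ^+ 2); last by rewrite expr2; ring.
  by rewrite ler_wpM2l ?dot_self_ge // mulr_ge0 // invr_ge0.
have proj_ge x y : K x -> K y -> `|x - y| <= 2 * `|proj x - proj y|.
  move=> Kx Ky; have := s_le x y Kx Ky.
  have : `|x - y| <= `|proj x - proj y| + `|(s x - s y) *: u|.
    apply: le_trans (ler_normD _ _); rewrite le_eqVlt; apply/orP; left; apply/eqP.
    by congr `|_|; rewrite /proj scalerBl; apply/rowP => i; rewrite !mxE; ring.
  by lra.
pose h a := xget 0 [set x | K x /\ proj x = a].
have hP x : K x -> h (proj x) = x.
  move=> Kx; have [Kh projh] : [set z | K z /\ proj z = proj x] (h (proj x)).
    by apply: (xgetI 0 (x := x)).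
  apply/eqP; rewrite -subr_eq0 -normr_eq0 eq_le normr_ge0 andbT.
  by apply: le_trans (proj_ge _ _ Kh Kx) _; rewrite projh subrr normr0 mulr0.
exists (lker (linfun (dot_fun u))), (proj @` K), (fun a => s (h a) *: u); split.
- exact: dim_ker_dot.
- split.
    apply: continuous_compact => //; apply: continuous_subspaceT => x.
    apply: (@continuousB _ _ _ id); first exact: cvg_id.
    apply: (@continuousZl _ _ _ s); apply: continuousM; last exact: cst_continuous.
    exact: dot_continuous.
  move=> _ [x Kx <-] /=; rewrite memv_ker lfunE /= /dot_fun dotBr dotZr /s.
  by rewrite divfK ?(gt_eqF uu0) // subrr.
- move=> a _ w /=; rewrite memv_ker lfunE /= => /eqP uw.
  rewrite mxE (eq_bigr (fun i => (s (h a) *: u) 0 i * w 0 i)).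
    by rewrite -/(dot _ _) dotZl [dot u w]uw mulr0.
  by move=> i _; rewrite !mxE.
- exists 1; split; first exact: num_real.
  move=> M M1 [_ _] [/= [x Kx <-] [y Ky <-]].
  rewrite !hP // -scalerBl; apply: le_trans (s_le x y Kx Ky) _.
  rewrite -[leRHS]mul1r; have := proj_ge x y Kx Ky.
  have := normr_ge0 (proj x - proj y); rewrite mul1r; nra.
- by move=> x Kx; exists (proj x); [exists x | rewrite hP // subrK].
Qed.

(** The slack [`|p - q| / 4] leaves room for replacing two distinct supergradients
    by rational vectors, and is small enough for [supergradient_pair_orthogonal]
    to feed [lipschitz_graph_orthogonal]. Testing the bounds on the whole ball that
    contains [x] makes them available between any two points of the set. *)
Definition supergradient_pair_set (f : 'rV[R]_n -> R) p q c (k : nat) :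
    set 'rV[R]_n :=
  [set x | `|x - c| < k.+1%:R^-1 /\ forall y, `|y - c| < k.+1%:R^-1 ->
     f y - f x <= dot p (y - x) + `|p - q| / 4 * `|y - x| /\
     f y - f x <= dot q (y - x) + `|p - q| / 4 * `|y - x|].

(** Adding the bound with [p] at one point to the bound with [q] at the other
    eliminates the function. *)
Lemma supergradient_pair_orthogonal f p q c k x y :
  supergradient_pair_set f p q c k x -> supergradient_pair_set f p q c k y ->
  `|dot (p - q) (x - y)| <= `|p - q| / 2 * `|x - y|.
Proof.
move=> [xc xP] [yc yP]; have [xp xq] := xP y yc; have [yp yq] := yP x xc.
move: xp xq yp yq; rewrite (distrC y x) -[y - x]opprB !dotNr dotBl => xp xq yp yq.
by rewrite ler_norml; apply/andP; split; lra.
Qed.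

Lemma supergradient_pair_cover f x p q : p != q ->
  near_supergradient f x p -> near_supergradient f x q ->
  exists (p' q' c : 'rV[rat]_n) (k : nat), p' != q' /\
    supergradient_pair_set f (ratv p') (ratv q') (ratv c) k x.
Proof.
move=> pq fp fq; pose d := `|p - q|.
have d0 : 0 < d by rewrite normr_gt0 subr_eq0.
have n1 : 0 < n%:R + 1 :> R by rewrite ltr_wpDl.
(* The error term of the supergradients and their replacement by rational vectors
   cost [d / 16] each, while the slack of the rational pair is at least
   [7 * d / 32]. *)
have t0 : 0 < d / 16 / (n%:R + 1) by rewrite !divr_gt0.
have d16 : 0 < d / 16 by rewrite divr_gt0.
have tle : d / 16 / (n%:R + 1) <= d / 16.
  by rewrite ler_pdivrMr // ler_peMr ?(ltW d16) // lerDr.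
have nt : n%:R * (d / 16 / (n%:R + 1)) <= d / 16.
  by rewrite mulrCA ler_piMr ?(ltW d16) // ler_pdivrMr // mul1r lerDl.
have [p' p'p] := ratv_dense p t0; have [q' q'q] := ratv_dense q t0.
have pq' : d - d / 8 <= `|ratv p' - ratv q'|.
  have : d <= `|ratv p' - ratv q'| + (`|ratv q' - q| + `|ratv p' - p|).
    have -> : d = `|(ratv p' - ratv q') + ((ratv q' - q) - (ratv p' - p))|.
      by congr `|_|; apply/rowP => i; rewrite !mxE; ring.
    by apply: le_trans (ler_normD _ _) _; rewrite lerD2l ler_normB.
  by lra.
have [r r0 rP] := fp _ d16; have [s s0 sP] := fq _ d16.
have m0 : 0 < Num.min r s / 2 by rewrite divr_gt0 // lt_min r0.
have [k kP] : exists k, k.+1%:R^-1 < Num.min r s / 2.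
  by have [k _ kP] := near_infty_natSinv_lt (PosNum m0); exists k; apply: kP => /=.
have k0 : 0 < k.+1%:R^-1 :> R by rewrite invr_gt0.
have [c cx] := ratv_dense x k0; exists p', q', c, k; split.
  apply/eqP => eqpq; move: pq'; rewrite eqpq subrr normr0; lra.
split=> [|y yc]; first by rewrite distrC.
have yx : `|y - x| < Num.min r s.
  rewrite -(subrKA (ratv c)) [ltRHS]splitr; apply: le_lt_trans (ler_normD _ _) _.
  by apply: ltrD; apply: lt_trans kP.
have dotle a b : `|ratv b - a| < d / 16 / (n%:R + 1) ->
    dot a (y - x) <= dot (ratv b) (y - x) + d / 16 * `|y - x|.
  move=> ab; rewrite -lerBlDl -dotBl; apply: le_trans (ler_norm _) _.
  apply: le_trans (dot_le _ _) _; rewrite mulrA ler_wpM2r //.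
  by apply: le_trans nt; rewrite ler_wpM2l // distrC ltW.
have yx0 := normr_ge0 (y - x).
move: yx; rewrite lt_min => /andP[/rP fyp /sP fyq].
have := dotle _ _ p'p; have := dotle _ _ q'q.
by split; nra.
Qed.

(** The closures of the countably many sets [supergradient_pair_set] with rational
    data are compact and still satisfy the inequality that makes them Lipschitz
    graphs. *)
Theorem countably_lipschitz_two_supergradients f (S : set 'rV[R]_n) :
  (forall x, S x -> exists p q,
     [/\ p != q, near_supergradient f x p & near_supergradient f x q]) ->
  countably_lipschitz_on S.
Proof.
move=> Spq.
pose Z (i : 'rV[rat]_n * 'rV[rat]_n * 'rV[rat]_n * nat) :=
  closure (supergradient_pair_set f (ratv i.1.1.1) (ratv i.1.1.2) (ratv i.1.2) i.2).
exists (Z @` [set i | i.1.1.1 != i.1.1.2]); split.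
- by apply: sub_countable (card_image_le _ _) _; apply: countableP.
- move=> _ [[[[p q] c] k] /= pq <-].
  have cZ : compact (Z (p, q, c, k)).
    apply: bounded_closed_compact; last exact: closed_closure.
    exists (`|ratv c| + 1); split; first exact: num_real.
    move=> M cM /= x Zx; have M0 : 0 < M - (`|ratv c| + 1) by rewrite subr_gt0.
    have [y /= [yc _] yx] := closure_dist Zx M0.
    have -> : x = ratv c + (y - ratv c) - (y - x).
      by apply/rowP => i; rewrite !mxE; ring.
    apply: le_trans (ler_normB _ _) _; apply: le_trans (lerD (ler_normD _ _) (lexx _)) _.
    have : k.+1%:R^-1 <= 1 :> R by rewrite invf_le1 // ler1n.
    move=> k1; apply: le_trans (lerD (lerD (lexx _) (ltW yc)) (ltW yx)) _.
    by move: (_^-1) `|ratv c| k1 => a b; lra.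
  split=> //; apply: (@lipschitz_graph_orthogonal _ (ratv p - ratv q)) => //.
    rewrite subr_eq0; apply: contra pq => /eqP/matrixP eqpq; apply/eqP/rowP => i.
    by have := eqpq 0 i; rewrite !mxE => /eqP; rewrite fmorph_eq => /eqP.
  set u := ratv p - ratv q => x y Zx Zy; apply/ler_addgt0Pl => e e0.
  have K0 : 0 < n%:R * `|u| + `|u| + 1 by have := mulr_ge0 (ler0n R n) (normr_ge0 u); have := normr_ge0 u; lra.
  have r0 : 0 < e / 2 / (n%:R * `|u| + `|u| + 1) by rewrite !divr_gt0.
  set r := _ / _ in r0.
  have [x' Zx' x'x] := closure_dist Zx r0; have [y' Zy' y'y] := closure_dist Zy r0.
  have := supergradient_pair_orthogonal Zx' Zy'; rewrite -/u => x'y'.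
  have uxy : `|dot u (x - y)| <= `|dot u (x' - y')| + n%:R * (`|u| * (2 * r)).
    have -> : x - y = (x' - y') + ((x - x') + (y' - y)).
      by apply/rowP => i; rewrite !mxE; ring.
    rewrite dotDr; apply: le_trans (ler_normD _ _) _; rewrite lerD2l.
    apply: le_trans (dot_le _ _) _; rewrite ler_wpM2l // ler_wpM2l //.
    apply: le_trans (ler_normD _ _) _; rewrite (distrC x); lra.
  have xy : `|x' - y'| <= `|x - y| + 2 * r.
    have -> : x' - y' = (x - y) + ((x' - x) - (y' - y)).
      by apply/rowP => i; rewrite !mxE; ring.
    apply: le_trans (ler_normD _ _) _; rewrite lerD2l.
    apply: le_trans (ler_normB _ _) _; lra.
  have : r * (n%:R * `|u| + `|u| + 1) = e / 2 by rewrite /r divfK // gt_eqF.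
  have := normr_ge0 u; have := normr_ge0 (x - y).
  have : `|u| / 2 * `|x' - y'| <= `|u| / 2 * (`|x - y| + 2 * r).
    by rewrite ler_wpM2l // divr_ge0.
  have : 0 <= `|u| * r by rewrite mulr_ge0 // ltW.
  move: uxy x'y'; lra.
- move=> x Sx; have [p [q [pq fp fq]]] := Spq x Sx.
  have [p' [q' [c [k [pq' Zx]]]]] := supergradient_pair_cover pq fp fq.
  by exists (Z (p', q', c, k)); [exists (p', q', c, k) | apply: subset_closure].
Qed.

End LipschitzGraphs.

Theorem countably_lipschitz_nondifferentiable (R : realType) (n : nat)
    (U : set 'rV[R]_n) (f : 'rV[R]_n -> R) :
  locally_semiconcave_on U f ->
  countably_lipschitz_on [set x | U x /\ ~ exists p, has_gradient f x p].
Proof.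
move=> sc; apply: (@countably_lipschitz_two_supergradients _ _ f).
move=> x [Ux nd]; have [V [oV Vx _ [w mw scV]]] := sc x Ux.
exact: two_supergradients mw oV Vx scV nd.
Qed.

(** * Semi-concavity does not depend on the chart *)

Lemma is_derive_dist (R : realType) (f : R -> R) (t d : R) :
  (forall e, 0 < e -> exists2 r, 0 < r & forall s, `|s| < r ->
     `|f (t + s) - f t - s * d| <= e * `|s|) ->
  is_derive t 1 f d.
Proof.
move=> fd; have cvgd : h^-1 *: ((f \o shift t) (h *: 1) - f t) @[h --> 0^'] --> d.
  apply/cvgrPdist_le => e e0; have [r r0 rP] := fd e e0.
  apply/nbhs_distP; exists r => // h; rewrite subr0 => hr h0.
  have h0' : 0 < `|h| by rewrite normr_gt0.
  rewrite distrC -(ler_pM2r h0') -normrM mulrBl /= [h *: 1]mulr1 (addrC h).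
  have -> : h^-1 *: (f (t + h) - f t) * h = f (t + h) - f t.
    by rewrite [_ *: _]mulrC mulfVK.
  by rewrite [d * h]mulrC; apply: rP.
apply: DeriveDef; first by apply/cvg_ex; exists d.
exact: cvg_lim cvgd.
Qed.

Section MeanValue.
Context (R : realType) (n m : nat).
Implicit Types (x y z h : 'rV[R]_n) (g : 'rV[R]_n -> 'rV[R]_m).

Lemma is_derive_line g x h (t : R) j : differentiable g (x + t *: h) ->
  is_derive t 1 (fun s : R => g (x + s *: h) 0 j) ('d g (x + t *: h) h 0 j).
Proof.
move=> /diff_locallyP[_ /eqaddoP go]; apply: is_derive_dist => e e0.
have h1 : 0 < `|h| + 1 by rewrite ltr_wpDl.
have /nbhs_distP[r r0 rP] := go (e / (`|h| + 1)) (divr_gt0 e0 h1).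
exists (r / (`|h| + 1)) => [|s]; first by rewrite divr_gt0.
rewrite ltr_pdivlMr // => sr.
have sh : `|s *: h - 0| < r.
  rewrite subr0 normrZ; apply: le_lt_trans sr.
  by rewrite ler_wpM2l // lerDl.
have := rP _ sh; rewrite !fctE /= linearZ /= normrZ => gs.
have -> : x + (t + s) *: h = s *: h + (x + t *: h) by rewrite scalerDl addrA addrC.
have gj := coord_le_norm (g (s *: h + (x + t *: h)) -
  (g (x + t *: h) + s *: 'd g (x + t *: h) h)) j.
rewrite !mxE opprD addrA in gj; apply: le_trans gj (le_trans gs _).
rewrite mulrCA mulrC ler_wpM2r // mulrAC ler_pdivrMr // ler_pM2l // lerDl.
by [].
Qed.

(** The sup norm reduces the mean value inequality to the mean value theorem for
    each coordinate. *)
Lemma mean_value_le g x y (C : R) : 0 <= C ->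
  (forall t : R, 0 <= t <= 1 -> differentiable g (x + t *: (y - x)) /\
     `|'d g (x + t *: (y - x)) (y - x)| <= C) ->
  `|g y - g x| <= C.
Proof.
move=> C0 dg; apply: norm_le_coord => // j.
pose F : R -> R := fun s => g (x + s *: (y - x)) 0 j.
pose dF : R -> R := fun s => 'd g (x + s *: (y - x)) (y - x) 0 j.
have dFP (t : R) : 0 <= t <= 1 -> is_derive t 1 F (dF t).
  by move=> t01; apply: is_derive_line; case: (dg t t01).
have [|||t t01 eqF] := @MVT_segment R F dF 0 1; first exact: ler01.
- by move=> t /andP[/= t0 t1]; apply: dFP; rewrite !ltW.
- apply: derivable_within_continuous => t; rewrite in_itv /= => /dFP.
  by case.
have -> : (g y - g x) 0 j = F 1 - F 0.
  by rewrite /F scale1r scale0r addr0 (addrC x) subrK !mxE.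
rewrite eqF subr0 mulr1; apply: le_trans (coord_le_norm _ j) _.
by move: t01; rewrite in_itv /= => /dg[].
Qed.

Lemma mean_value_linear_le g (D : {linear 'rV[R]_n -> 'rV[R]_m}) x y (C : R) :
  0 <= C -> continuous D ->
  (forall t : R, 0 <= t <= 1 -> differentiable g (x + t *: (y - x)) /\
     `|'d g (x + t *: (y - x)) (y - x) - D (y - x)| <= C) ->
  `|g y - g x - D (y - x)| <= C.
Proof.
move=> C0 cD dg; pose D' : 'rV[R]_n -> 'rV[R]_m := D.
have dD z : differentiable D' z by exact: linear_differentiable.
have dDz z : 'd D' z = D :> ('rV[R]_n -> 'rV[R]_m) by exact: diff_lin.
have -> : g y - g x - D (y - x) = (g - D') y - (g - D') x.
  by rewrite !fctE /D' linearB /=; apply/rowP => i; rewrite !mxE; ring.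
apply: mean_value_le; first exact: C0.
move=> t t01; have [dgz dgC] := dg t t01.
set z := x + _ in dgz dgC *.
split; first exact: differentiableB dgz (dD z).
have dG := congr1 (fun F : 'rV[R]_n -> 'rV[R]_m => F (y - x)) (diffB dgz (dD z)).
have dDe := congr1 (fun F : 'rV[R]_n -> 'rV[R]_m => F (y - x)) (dDz z).
have eqd := etrans dG (congr1 (fun v => 'd g z (y - x) - v) dDe).
by rewrite [X in `|X|]eqd; exact: dgC.
Qed.

End MeanValue.

Section Taylor.
Context (R : realType) (n m : nat).
Implicit Types (x y z h : 'rV[R]_n) (g : 'rV[R]_n -> 'rV[R]_m).

Lemma linear_le_basis (D : {linear 'rV[R]_n -> 'rV[R]_m}) h (C : 'I_n -> R) :
  (forall i, `|D (delta_mx 0 i)| <= C i) -> `|D h| <= (\sum_i C i) * `|h|.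
Proof.
move=> DC; rewrite {1}(row_sum_delta h) linear_sum.
apply: le_trans (ler_norm_sum _ _ _) _; rewrite mulr_suml; apply: ler_sum => i _.
by rewrite linearZ normrZ mulrC ler_pM // coord_le_norm.
Qed.

Lemma linear_sub_le_basis (D D' : {linear 'rV[R]_n -> 'rV[R]_m}) h
    (C : 'I_n -> R) :
  (forall i, `|D (delta_mx 0 i) - D' (delta_mx 0 i)| <= C i) ->
  `|D h - D' h| <= (\sum_i C i) * `|h|.
Proof. exact: (linear_le_basis (D := D \- D')). Qed.

Lemma segment_dist x y (t : R) : 0 <= t <= 1 -> `|x + t *: (y - x) - x| <= `|y - x|.
Proof.
by move=> /andP[t0 t1]; rewrite addrC addKr normrZ ger0_norm // ler_piMl.
Qed.

Lemma segment_ball x y z (r t : R) : 0 <= t <= 1 -> `|x - z| < r -> `|y - z| < r ->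
  `|x + t *: (y - x) - z| < r.
Proof.
move=> /andP[t0 t1] xz yz.
have -> : x + t *: (y - x) - z = (1 - t) *: (x - z) + t *: (y - z).
  by apply/rowP => i; rewrite !mxE; ring.
apply: le_lt_trans (ler_normD _ _) _; rewrite !normrZ ger0_norm ?subr_ge0 // ger0_norm //.
have [->|t0'] := eqVneq t 0; first by rewrite subr0 mul1r mul0r addr0.
have : t * `|y - z| < t * r by rewrite ltr_pM2l // lt_neqAle eq_sym t0'.
have : (1 - t) * `|x - z| <= (1 - t) * r by rewrite ler_wpM2l ?subr_ge0 // ltW.
lra.
Qed.

(** Continuity bounds the derivative near the point in each of the finitely many
    basis directions, hence in all directions. *)
Lemma C1_lipschitz (W : set 'rV[R]_n) g u : open W -> W u -> Ck 1 W g ->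
  exists L r : R, [/\ 0 <= L, 0 < r, (forall x, `|x - u| < r -> W x),
    (forall x h, `|x - u| < r -> `|'d g x h| <= L * `|h|) &
    forall x y, `|x - u| < r -> `|y - u| < r -> `|g y - g x| <= L * `|y - x|].
Proof.
move=> oW Wu [dg cdg].
have : \forall x \near u, forall i : 'I_n,
    `|'d g x (delta_mx 0 i)| <= `|'d g u (delta_mx 0 i)| + 1.
  apply: (@filter_forall _ _ (fun (i : 'I_n) x =>
    `|'d g x (delta_mx 0 i)| <= `|'d g u (delta_mx 0 i)| + 1) (nbhs u)) => i.
  have /continuous_distP/(_ _ ltr01)[r r0 rP] := cdg (delta_mx 0 i) u Wu.
  apply/nbhs_distP; exists r => // x /rP dx.
  by rewrite -lerBlDl; apply: le_trans (ler_dist_dist _ _) dx || apply: le_trans (lerB_dist _ _) dx.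
move=> /nbhs_distP[r r0 rP]; have /nbhs_distP[s s0 sW] := open_nbhs_nbhs (conj oW Wu).
pose L := \sum_i (`|'d g u (delta_mx 0 i)| + 1).
have L0 : 0 <= L by apply: sumr_ge0 => i _; rewrite addr_ge0.
have dL x h : `|x - u| < Num.min r s -> `|'d g x h| <= L * `|h|.
  by rewrite lt_min => /andP[xr _]; apply: linear_le_basis => i; apply: rP.
exists L, (Num.min r s); split=> //; first by rewrite lt_min r0.
  by move=> x; rewrite lt_min => /andP[_ /sW].
move=> x y xu yu; apply: mean_value_le => [|t t01]; first by rewrite mulr_ge0.
have zu := segment_ball t01 xu yu; split; last exact: dL.
by apply/dg/sW; move: zu; rewrite lt_min => /andP[].
Qed.

End Taylor.

Section Taylor2.
Context (R : realType) (n m : nat).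
Implicit Types (x y z h : 'rV[R]_n) (g : 'rV[R]_n -> 'rV[R]_m).

(** The derivative is Lipschitz, so the derivative of the Taylor remainder along
    the segment from [x] to [y] is bounded by a multiple of the length of the
    segment; the mean value inequality gives one more factor. *)
Lemma C2_taylor (W : set 'rV[R]_n) g u : open W -> W u -> Ck 2 W g ->
  exists L K r : R, [/\ 0 <= L, 0 <= K, 0 < r, (forall x, `|x - u| < r -> W x) &
    forall x y, `|x - u| < r -> `|y - u| < r -> `|g y - g x| <= L * `|y - x| /\
      `|g y - g x - 'd g x (y - x)| <= K * `|y - x| * `|y - x|].
Proof.
move=> oW Wu [dg ddg].
have C1g : Ck 1 W g.
  by split=> // v x Wx; apply: differentiable_continuous; case: (ddg v) => + _; apply.
have [L [r [L0 r0 rW _ rL]]] := C1_lipschitz oW Wu C1g.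
have /choice[Kr KrP] i : exists Kr : R * R, [/\ 0 <= Kr.1, 0 < Kr.2 &
    forall x y, `|x - u| < Kr.2 -> `|y - u| < Kr.2 ->
    `|'d g y (delta_mx 0 i) - 'd g x (delta_mx 0 i)| <= Kr.1 * `|y - x|].
  have [K [s [K0 s0 _ _ sK]]] := C1_lipschitz oW Wu (ddg (delta_mx 0 i)).
  by exists (K, s).
have : \forall x \near u, forall i : 'I_n, `|x - u| < (Kr i).2.
  apply: (@filter_forall _ _ (fun (i : 'I_n) x => `|x - u| < (Kr i).2) (nbhs u)) => i.
  by apply/nbhs_distP; exists (Kr i).2 => //; case: (KrP i).
move=> /nbhs_distP[s s0 sP].
pose K := \sum_i (Kr i).1.
have K0 : 0 <= K by apply: sumr_ge0 => i _; case: (KrP i).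
exists L, K, (Num.min r s); split=> //; first by rewrite lt_min r0.
  by move=> x; rewrite lt_min => /andP[/rW].
move=> x y xu yu; have [xr xs] : `|x - u| < r /\ `|x - u| < s.
  by move: xu; rewrite lt_min => /andP.
have [yr ys] : `|y - u| < r /\ `|y - u| < s by move: yu; rewrite lt_min => /andP.
split; first exact: rL.
have cD : continuous ('d g x) by apply: diff_continuous; exact/dg/rW.
apply: (mean_value_linear_le _ cD) => [|t t01]; first by rewrite !mulr_ge0.
set z := x + _; have zu := segment_ball t01 xu yu; rewrite -/z in zu.
have [zr zs] : `|z - u| < r /\ `|z - u| < s by move: zu; rewrite lt_min => /andP.
split; first exact/dg/rW.
apply: (@le_trans _ _ (K * `|z - x| * `|y - x|)); last first.
  have zx : `|z - x| <= `|y - x| := segment_dist x y t01.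
  apply: ler_wpM2r; first exact: normr_ge0.
  exact: ler_wpM2l.
rewrite /K mulr_suml; apply: linear_sub_le_basis => i.
by have [_ _] := KrP i; apply; apply: sP.
Qed.

End Taylor2.

Lemma modulus_dilation (R : realType) (w : R -> R) (c L : R) :
  modulus w -> 0 <= c -> 0 <= L -> modulus (fun a => c * a + L * w (L * a)).
Proof.
move=> [cw wmono wge0 w0] c0 L0; split.
- apply/subspace_continuousP => a /= a0; apply/cvgrPdist_le => e e0.
  have e2 : 0 < e / 2 by rewrite divr_gt0.
  have L1 : 0 < L + 1 by rewrite ltr_wpDl.
  have c1 : 0 < c + 1 by rewrite ltr_wpDl.
  have La0 : 0 <= L * a by rewrite mulr_ge0.
  have /subspace_continuousP/(_ (L * a) La0)/cvgrPdist_le := cw.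
  move=> /(_ _ (divr_gt0 e2 L1))/nbhs_distP[d d0 dP].
  apply/nbhs_distP; exists (Num.min (d / (L + 1)) (e / 2 / (c + 1))).
    by rewrite lt_min !divr_gt0.
  move=> b; rewrite lt_min ltr_pdivlMr // [_ < e / 2 / _]ltr_pdivlMr //.
  move=> /andP[bd bc] /= b0.
  have : `|w (L * a) - w (L * b)| <= e / 2 / (L + 1).
    apply: (dP (L * b)); last by rewrite /= mulr_ge0.
    rewrite -mulrBr normrM ger0_norm //; apply: le_lt_trans bd.
    by rewrite mulrC ler_wpM2l // lerDl.
  rewrite ler_pdivlMr // => wab.
  rewrite /from_subspace (_ : _ - _ = c * (a - b) + L * (w (L * a) - w (L * b))); last by ring.
  apply: le_trans (ler_normD _ _) _.
  rewrite normrM (ger0_norm c0) normrM (ger0_norm L0) [e]splitr; apply: lerD.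
    by apply: le_trans (ltW bc); rewrite distrC mulrC ler_wpM2l // lerDl.
  by apply: le_trans wab; rewrite mulrC ler_wpM2l // lerDl.
- move=> a b a0 ab; apply: lerD; first by rewrite ler_wpM2l.
  by rewrite ler_wpM2l // wmono ?mulr_ge0 // ler_wpM2l.
- move=> a a0; have wa : 0 <= w (L * a) by rewrite wge0 // mulr_ge0.
  by rewrite addr_ge0 // mulr_ge0.
- by rewrite !mulr0 w0 mulr0 addr0.
Qed.

(** The supergradients of [f], composed with the derivative of [t], are
    supergradients of the composition: the quadratic Taylor remainder of [t] is
    absorbed in the modulus because supergradients are locally bounded. That bound
    depends on [f], so the new modulus does too. *)
Lemma locally_semiconcave_comp (R : realType) (n m : nat)
    (W : set 'rV[R]_n) (V : set 'rV[R]_m) (t : 'rV[R]_n -> 'rV[R]_m)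
    (f : 'rV[R]_m -> R) (w : R -> R) (g : 'rV[R]_n -> R) (u : 'rV[R]_n) :
  open W -> W u -> Ck 2 W t -> open V -> (forall x, W x -> V (t x)) ->
  modulus w -> semiconcave w V f -> (forall x, W x -> g x = f (t x)) ->
  exists X : set 'rV[R]_n, [/\ open X, X u, X `<=` W &
    exists2 w' : R -> R, modulus w' & semiconcave w' X g].
Proof.
move=> oW Wu C2t oV WV mw scf gft; have sc := proj1 (semiconcaveP _ _ _) scf.
have [L [K [r [L0 K0 r0 rW tP]]]] := C2_taylor oW Wu C2t.
have [B [s [s0 sV BP]]] := supergradient_locally_bounded mw oV (WV u Wu) sc.
have uu : `|u - u| < r by rewrite subrr normr0.
have L1 : 0 < L + 1 by rewrite ltr_wpDl.
pose r' := Num.min r (s / (L + 1)).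
have r'0 : 0 < r' by rewrite lt_min r0 divr_gt0.
have ts x : `|x - u| < r' -> `|t x - t u| <= s.
  rewrite lt_min ltr_pdivlMr // => /andP[xr xs].
  have [tx _] := tP u x uu xr; apply: le_trans tx (le_trans _ (ltW xs)).
  by rewrite mulrC ler_wpM2l // lerDl.
have B0 : 0 <= B.
  have [p pu] := sc _ (WV u Wu); apply: le_trans (BP (t u) p _ pu) => //.
  by rewrite subrr normr0 ltW.
case: (mw) => cw wmono wge0 w0.
pose w' (a : R) := m%:R * (B * K) * a + L * w (L * a).
exists [set x | `|x - u| < r']; split.
- by rewrite openE => x /= xr; apply/nbhs_distP; exists (r' - `|x - u|); rewrite ?subr_gt0 // => y;
    rewrite ltrBrDr; apply: le_lt_trans; rewrite -(subrKA x) ler_normD.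
- by rewrite /= subrr normr0.
- by move=> x /=; rewrite lt_min => /andP[/rW].
exists w'.
  by apply: modulus_dilation => //; rewrite !mulr_ge0.
move=> x /= xu; have xr : `|x - u| < r by move: xu; rewrite lt_min => /andP[].
have [p px] := sc (t x) (WV _ (rW _ xr)).
pose D : {linear 'rV[R]_n -> 'rV[R]_m} := 'd t x.
exists (dot_fun p \o D) => y yu /=.
have yr : `|y - u| < r by move: yu; rewrite lt_min => /andP[].
rewrite !gft; try exact: rW.
apply: le_trans (px (t y) (WV _ (rW _ yr))) _.
have [tL tK] := tP x y xr yr; rewrite -/D in tK.
have pB : `|p| <= B by apply: BP px; apply: ts.
have yx0 := normr_ge0 (y - x).
have -> : dot p (t y - t x) = dot_fun p (D (y - x)) + dot p (t y - t x - D (y - x)).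
  by rewrite [dot p (_ - D _)]dotBr /dot_fun addrCA subrr addr0.
rewrite -addrA lerD2l /w' mulrDr; apply: lerD.
  apply: le_trans (ler_norm _) _; apply: le_trans (dot_le _ _) _.
  apply: (@le_trans _ _ (m%:R * (B * (K * `|y - x| * `|y - x|)))).
    by rewrite ler_wpM2l // ler_pM.
  by rewrite le_eqVlt; apply/orP; left; apply/eqP; ring.
rewrite mulrA (mulrC _ L); apply: ler_pM => //; first exact: wge0.
by apply: wmono.
Qed.

(** * Differentials on a manifold *)

Lemma has_gradient_near_eq (R : realType) (n : nat) (f g : 'rV[R]_n -> R) x p :
  (\forall y \near x, f y = g y) -> has_gradient g x p -> has_gradient f x p.
Proof.
move=> fg gp e /gp[r r0 rP].
have /nbhs_distP[s s0 sP] := fg; exists (Num.min r s) => [|y].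
  by rewrite lt_min r0.
rewrite lt_min => /andP[yr ys]; rewrite (sP y ys) (sP x) ?subrr ?normr0 //.
exact: rP.
Qed.

Lemma linear_ext (R : pzRingType) (V W : lmodType R) (f g : {linear V -> W}) :
  f =1 g -> f = g.
Proof.
case: f => f [[fa] [fs]]; case: g => g [[ga] [gs]] /= /funext fg; subst g.
by rewrite (Prop_irrelevance fa ga) (Prop_irrelevance fs gs).
Qed.

Section ManifoldDifferential.
Context (R : realType) (n : nat) (M : topologicalType).
Context (S : smooth_structure R n M).
Implicit Types (a b : chart R n M) (x : M) (f : M -> R).

Lemma chart_img_open_at a x : chart_dom a x -> nbhs (a x) (chart_img a).
Proof.
move=> ax; apply: open_nbhs_nbhs; split; first exact: chart_img_open.
by exists x.
Qed.

Definition overlap a b : set 'rV[R]_n := a @` (chart_dom a `&` chart_dom b).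

Lemma overlapE a b :
  overlap a b = chart_img a `&` chart_inv a @^-1` chart_dom b.
Proof.
apply/seteqP; split=> [_ [x [ax bx] <-]|_ [[x ax <-]]] /=.
  by split; [exists x | rewrite /= chart_mapK].
by rewrite chart_mapK // => bx; exists x.
Qed.

Lemma overlap_open a b : open (overlap a b).
Proof.
rewrite overlapE openE => _ [[x ax <-]] /=; rewrite chart_mapK // => bx.
apply: filterI; first exact: chart_img_open_at.
apply: (chart_inv_continuous (c := a)); first by exists x.
by rewrite chart_mapK //; apply: open_nbhs_nbhs; split=> //; apply: chart_dom_open.
Qed.

Lemma transition_at a b x : chart_dom a x -> transition a b (a x) = b x.
Proof. by move=> ax; rewrite /transition /= chart_mapK. Qed.

Lemma transitionK a b u : overlap a b u ->
  chart_inv a u = chart_inv b (transition a b u).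
Proof. by move=> [x [ax bx] <-]; rewrite transition_at // !chart_mapK. Qed.

Lemma transition_smooth a b : atlas S a -> atlas S b ->
  smooth_on (overlap a b) (transition a b).
Proof. by move=> Sa Sb; case: (atlas_compatible Sa Sb). Qed.

Lemma has_gradient_chart f a b x p : atlas S a -> atlas S b ->
  chart_dom a x -> chart_dom b x ->
  has_gradient (f \o chart_inv b) (b x) p ->
  exists q, has_gradient (f \o chart_inv a) (a x) q /\
    forall v, dot q v = dot p ('d (transition a b) (a x) v).
Proof.
move=> Sa Sb ax bx fp; set t := transition a b.
have abx : overlap a b (a x) by exists x.
have dt : differentiable t (a x) by case: (transition_smooth Sa Sb 1) => + _; apply.
rewrite -(transition_at b ax) -/t in fp.
have [dfb dfbE] := has_gradient_differentiable fp.
pose fb : 'rV[R]_n -> R^o := f \o chart_inv b.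
have dcomp : differentiable (fb \o t) (a x) by exact: differentiable_comp dt dfb.
have [q qE] := linear_dot ('d (fb \o t) (a x)).
exists q; split.
  apply: (@has_gradient_near_eq _ _ _ (fb \o t)); last exact: differentiable_has_gradient.
  have nab : nbhs (a x) (overlap a b).
    by apply: open_nbhs_nbhs; split=> //; apply: overlap_open.
  by apply: filterS nab => u /transitionK; rewrite /fb /= => ->.
move=> v; rewrite -qE -dfbE.
exact: (congr1 (fun F : 'rV[R]_n -> R^o => F v) (diff_comp dt dfb)).
Qed.

(** By the chain rule a gradient in one chart yields gradients in all charts, and
    these are related as the coordinates of a covector are. *)
Lemma differentiable_atP f x (a : chart_at S x) : differentiable_at S f x <->
  exists p, has_gradient (f \o chart_inv (sval a)) (sval a x) p.
Proof.
split=> [[p /(_ a)[/differentiableP_gradient]]|[p fp]]; first by [].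
have Df (b : chart_at S x) : exists q, has_gradient (f \o chart_inv (sval b)) (sval b x) q.
  have [q [fq _]] := has_gradient_chart (proj1 (svalP b)) (proj1 (svalP a))
    (proj2 (svalP b)) (proj2 (svalP a)) fp.
  by exists q.
pose D (b : chart_at S x) : {linear 'rV[R]_n -> R^o} :=
  'd (f \o chart_inv (sval b) : 'rV[R]_n -> R^o) (sval b x).
have compD (b c : chart_at S x) (v : 'rV[R]_n) :
    D b v = D c ('d (transition (sval b) (sval c)) (sval b x) v).
  have [q fq] := Df c.
  have [q' [fq' q'E]] := has_gradient_chart (proj1 (svalP b)) (proj1 (svalP c))
    (proj2 (svalP b)) (proj2 (svalP c)) fq.
  have [_ dE] := has_gradient_differentiable fq.
  have [_ dE'] := has_gradient_differentiable fq'.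
  exact: (etrans (dE' v) (etrans (q'E v) (esym (dE _)))).
exists (Covector compD) => b fb; split=> //.
by apply/differentiableP_gradient; apply: Df.
Qed.

Lemma differentialE f x (a : chart_at S x) p :
  has_gradient (f \o chart_inv (sval a)) (sval a x) p ->
  forall v, differential S f x a v = dot p v.
Proof.
move=> fp v; rewrite /differential; case: pselect => [h|[]]; last first.
  by apply/(differentiable_atP f a); exists p.
have [_ <-] := svalP (cid h) a; have [_] := has_gradient_differentiable fp.
exact.
Qed.

(** The compatibility condition recovers the coordinates in the other charts. *)
Lemma covector_ext x (a : chart_at S x) (p q : covector S x) :
  (forall v, p a v = q a v) -> p = q.
Proof.
move=> pq; have eqpq : covec p = covec q.
  apply/funext => b; apply: linear_ext => v.
  by rewrite (covec_compatible p b a) (covec_compatible q b a) pq.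
case: p q eqpq {pq} => [p pc] [q qc] /= eqpq; subst q.
by rewrite (Prop_irrelevance pc qc).
Qed.

Lemma cotangent_inj x (p q : covector S x) :
  existT (covector S) x p = existT (covector S) x q -> p = q.
Proof.
move=> e; have := projT2_eq e.
by rewrite (Prop_irrelevance (projT1_eq e) erefl).
Qed.

(** This turns equations between cotangent vectors into statements about
    gradients in an arbitrary chart. *)
Lemma left_twist_gradient (N : topologicalType) (c : M * N -> R) f x
    (a : chart_at S x) y q :
  has_gradient (f \o chart_inv (sval a)) (sval a x) q ->
  (left_twist_dom S c (x, y) /\
   left_twist S c (x, y) = existT _ x (covec_opp (differential S f x))) <->
  has_gradient ((fun x' => c (x', y)) \o chart_inv (sval a)) (sval a x) (- q).
Proof.
move=> fq; have fE := differentialE fq; split.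
  move=> [/(differentiable_atP _ a)[p cp] /cotangent_inj eqd].
  suff <- : p = - q by [].
  apply/eqP; rewrite -subr_eq0; apply/eqP/dot_eq0 => v.
  have e : dot p v = - dot q v.
    apply: (etrans (esym (differentialE cp v))).
    exact: (etrans (congr1 (fun w : covector S x => w a v) eqd) (congr1 -%R (fE v))).
  by rewrite dotBl dotNl e subrr.
move=> cq; split; first by apply/(differentiable_atP _ a); exists (- q).
congr existT; apply: (@covector_ext x a) => v.
by rewrite (differentialE cq) /= fE dotNl.
Qed.

End ManifoldDifferential.

(** * Borel sets of points of differentiability *)

Lemma polish_normed (R : realType) (V : normedModType R) :
  (forall F : set_system V, ProperFilter F -> cauchy F -> cvg F) ->
  (exists2 Q : set V, countable Q & forall (x : V) (e : R), 0 < e ->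
     exists2 y, Q y & `|y - x| < e) ->
  polish_space R V.
Proof.
move=> complV [Q cQ dQ]; split; last first.
  exists Q => // U [x Ux] oU.
  have /nbhs_distP[r r0 rU] := open_nbhs_nbhs (conj oU Ux).
  by have [y Qy yx] := dQ x r r0; exists y; split=> //; apply: rU.
exists (fun x y => `|y - x|); split.
- move=> x y; split=> [/eqP|->]; last by rewrite subrr normr0.
  by rewrite normr_eq0 subr_eq0 => /eqP.
- by move=> x y; rewrite distrC.
- by move=> x y z; rewrite -(subrKA y) [leRHS]addrC ler_normD.
- exact: nbhs_distP.
- move=> u cu; have cau : cauchy (u @ \oo).
    apply/cauchy_ballP => e e0; have [k kP] := cu e e0.
    exists (u @` [set i | (k <= i)%N], u @` [set i | (k <= i)%N]).
      by split; exists k => // i /= ki; exists i.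
    move=> [_ _] [/= [i ki <-] [j kj <-]]; rewrite -ball_normE /=.
    exact: kP.
  by apply/cvg_ex; apply: complV cau.
Qed.

Lemma polish_rV (R : realType) (n : nat) : polish_space R 'rV[R]_n.
Proof.
apply: polish_normed => [F FF cF|]; first exact: cauchy_cvg.
exists (range (@ratv R n)).
  by apply: sub_countable (card_image_le _ _) _; apply: countableP.
by move=> x e e0; have [r rx] := ratv_dense x e0; exists (ratv R r).
Qed.

Lemma polish_R (R : realType) : polish_space R R.
Proof.
apply: polish_normed => [F FF cF|]; first exact: cauchy_cvg.
exists (range (@ratr R)).
  by apply: sub_countable (card_image_le _ _) _; apply: countableP.
move=> x e e0; have [|r] := @rat_in_itvoo R (x - e) (x + e).
  by rewrite ltrBlDr -addrA ltrDl addr_gt0.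
rewrite in_itv /= => /andP[? ?]; exists (ratr r); first by exists r.
by rewrite ltr_distl; apply/andP.
Qed.

Lemma borel_funD (R : realType) (T : topologicalType) (f g : T -> R) :
  borel_fun f -> borel_fun g -> borel_fun (fun x => f x + g x).
Proof.
move=> bf bg B bB.
have bfg := borel_fun_pair (polish_second_countable 0 (polish_R R)) bf bg.
apply: (bfg ((fun z : R * R => z.1 + z.2) @^-1` B)); apply: borel_preimage => //.
by move=> z; apply: (@continuousD _ _ _ fst snd); [exact: cvg_fst | exact: cvg_snd].
Qed.

(** By continuity in the vector, the condition may be tested on rational vectors,
    with [e] and [r] inverses of integers; this leaves countably many operations
    on Borel sets. The set [D h] is where [G t h] is meaningful. *)
Lemma borel_little_o (R : realType) (n : nat) (T : topologicalType)
    (A : set T) (G : T -> 'rV[R]_n -> R) (D : 'rV[rat]_n -> set T) :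
  borel A ->
  (forall h (s : R), borel (D h `&` [set t | G t (ratv R h) <= s])) ->
  (forall t, A t -> exists2 r : R, 0 < r & forall h : 'rV[R]_n, `|h| < r ->
     {for h, continuous (G t)}) ->
  (forall t, A t -> exists2 r : R, 0 < r & forall h : 'rV[rat]_n, `|ratv R h| < r ->
     D h t) ->
  borel (A `&` [set t | forall e : R, 0 < e -> exists2 r : R, 0 < r &
    forall h, `|h| < r -> G t h <= e * `|h|]).
Proof.
move=> bA bD cG DA.
pose q (k : nat) : R := k.+1%:R^-1.
have q0 k : 0 < q k by rewrite invr_gt0.
have qs (e : R) : 0 < e -> exists k, q k < e.
  by move=> e0; have [k _ kP] := near_infty_natSinv_lt (PosNum e0); exists k; apply: kP => /=.
rewrite (_ : _ `&` _ = A `&` [set t | forall k, exists m, forall h : 'rV[rat]_n,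
    ([set _ | q m <= `|ratv R h|] `|`
     (D h `&` [set t | G t (ratv R h) <= q k * `|ratv R h|])) t]).
  apply: borelI => //; apply: borel_forall => k; apply: borel_exists => m.
  apply: borel_forall => h; apply: borelU; first exact: borel_cst.
  exact: bD.
apply/seteqP; split=> t [At tP]; split=> //; [move=> k | move=> e e0].
  have [r r0 rP] := tP _ (q0 k); have [s s0 sP] := DA t At.
  have [|m qm] := qs (Num.min r s); first by rewrite lt_min r0.
  exists m => h; have [hm|hm] := leP (q m) `|ratv R h|; [by left | right].
  have := lt_trans hm qm; rewrite lt_min => /andP[hr hs].
  by split; [apply: sP | apply: rP].
have [k qk] := qs e e0; have [m mP] := tP k; have [s s0 sP] := cG t At.
exists (Num.min (q m) s) => [|h]; first by rewrite lt_min q0.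
rewrite lt_min => /andP[hm hs]; apply: le_trans (_ : q k * `|h| <= _); last first.
  by rewrite ler_wpM2r // ltW.
apply/ler_addgt0Pl => d d0; have d2 : 0 < d / 2 by rewrite divr_gt0.
have /continuous_distP/(_ _ d2)[r r0 rP] := sP h hs.
have r'0 : 0 < Num.min r (Num.min (q m - `|h|) (d / 2 / q k)).
  by rewrite !lt_min r0 subr_gt0 hm divr_gt0.
have [h' +] := ratv_dense h r'0; rewrite !lt_min => /andP[hr /andP[hq hd]].
have h'h : `|ratv R h'| <= `|h| + `|ratv R h' - h|.
  by rewrite addrC -{1}(subrK h (ratv R h')) ler_normD.
have [|[_ Gh']] := mP h'; first by rewrite leNgt; case/negP; lra.
have := rP _ hr; rewrite ler_norml => /andP[Gh _].
move: hd; rewrite ltr_pdivlMr // => hd.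
have : q k * `|ratv R h'| <= q k * (`|h| + `|ratv R h' - h|) by rewrite ler_pM2l.
move: Gh' Gh hd => /=; lra.
Qed.

Lemma translate_continuousl (R : realType) (V : normedModType R) (T : topologicalType)
    (f : V -> T) (u h : V) :
  {for u + h, continuous f} -> {for u, continuous (fun z => f (z + h))}.
Proof.
move=> cf; apply: (@continuous_comp _ _ _ (fun z => z + h) f) => //.
by apply: continuousD; [exact: cvg_id | exact: cst_continuous].
Qed.

Lemma translate_continuousr (R : realType) (V : normedModType R) (T : topologicalType)
    (f : V -> T) (u h : V) :
  {for u + h, continuous f} -> {for h, continuous (fun k => f (u + k))}.
Proof.
move=> cf; apply: (@continuous_comp _ _ _ (fun k => u + k) f) => //.
by apply: continuousD; [exact: cst_continuous | exact: cvg_id].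
Qed.

Lemma reflect_continuous (R : realType) (V : normedModType R) (T : topologicalType)
    (f : V -> T) (u h : V) :
  {for u - h, continuous f} -> {for h, continuous (fun k => f (u - k))}.
Proof.
move=> cf; apply: (@continuous_comp _ _ _ (fun k => u - k) f) => //.
by apply: continuousB; [exact: cst_continuous | exact: cvg_id].
Qed.

Section ChartBorel.
Context (R : realType) (n : nat).

(** Supergradients exist everywhere, so differentiability is the criterion
    [near_supergradient_differentiable] on second differences, which are
    continuous. *)
Theorem borel_differentiability (U : set 'rV[R]_n) (f : 'rV[R]_n -> R) :
  open U -> locally_semiconcave_on U f ->
  borel (U `&` [set u | exists p, has_gradient f u p]).
Proof.
move=> oU sc.
have cf u : U u -> {for u, continuous f}.
  move=> Uu; have [V [oV Vu VU [w mw scV]]] := sc u Uu.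
  exact: semiconcave_continuous mw oV Vu scV.
pose G u h := 2 * f u - f (u + h) - f (u - h).
have -> : U `&` [set u | exists p, has_gradient f u p] =
    U `&` [set u | forall e : R, 0 < e -> exists2 r : R, 0 < r &
    forall h, `|h| < r -> G u h <= e * `|h|].
  apply/seteqP; split=> u [Uu fu]; split=> //;
    have [V [oV Vu VU [w mw /semiconcaveP/(_ u Vu)[p pu]]]] := sc u Uu;
    have crit := near_supergradient_differentiable (supergradient_near mw oV Vu pu).
    move=> e e0; have [r r0 rP] := proj1 crit fu e e0.
    by exists r => // h /rP; rewrite /G; lra.
  apply/crit => e e0; have [r r0 rP] := fu e e0.
  by exists r => // h /rP; rewrite /G; lra.
pose D (h : 'rV[rat]_n) := [set u | [/\ U u, U (u + ratv R h) & U (u - ratv R h)]].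
apply: (borel_little_o (D := D)); first exact: borel_open.
- move=> h s; rewrite (_ : [set t | _] = (fun t => G t (ratv R h)) @^-1` [set r | r <= s]) //.
  apply: borel_preimage_open; last by apply: borel_closed; exact: closed_le.
    rewrite openE => u [Uu Uh Uh'].
    have [r r0 rU] := open_distP oU Uu; have [r' r'0 rU'] := open_distP oU Uh.
    have [r'' r''0 rU''] := open_distP oU Uh'.
    apply/nbhs_distP; exists (Num.min r (Num.min r' r'')); first by rewrite !lt_min r0 r'0.
    move=> v; rewrite !lt_min => /andP[/ltW vr /andP[/ltW vr' /ltW vr'']].
    split; [exact: rU | apply: rU' | apply: rU''].
      by rewrite opprD addrACA subrr addr0.
    by rewrite opprB subrKA.
  move=> u [Uu Uh Uh']; rewrite /G.
  apply: continuousB; last by apply: (@translate_continuousl _ _ _ f); apply: cf.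
  apply: continuousB; last by apply: (@translate_continuousl _ _ _ f); apply: cf.
  by apply: continuousM; [exact: cst_continuous | exact: cf].
- move=> u Uu; have [r r0 rU] := open_distP oU Uu; exists r => // h hr.
  have Uh : U (u + h) by apply: rU; rewrite addrC addKr ltW.
  have Uh' : U (u - h) by apply: rU; rewrite addrC addKr normrN ltW.
  rewrite /G; apply: continuousB.
    apply: continuousB; first exact: cst_continuous.
    by apply: (@translate_continuousr _ _ _ f); apply: cf.
  by apply: (@reflect_continuous _ _ _ f); apply: cf.
- move=> u Uu; have [r r0 rU] := open_distP oU Uu; exists r => // h hr.
  split=> //; apply: rU; first by rewrite addrC addKr ltW.
  by rewrite addrC addKr normrN ltW.
Qed.

End ChartBorel.

Section CriticalPoints.
Context (R : realType) (n : nat) (M N : topologicalType).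

Lemma shift_chart_continuous (a : chart R n M) (h : 'rV[R]_n) (z : M * N) :
  chart_dom a z.1 -> chart_img a (a z.1 + h) ->
  {for z, continuous (fun z : M * N => (chart_inv a (a z.1 + h), z.2))}.
Proof.
move=> az ah; apply: cvg_pair; last exact: cvg_snd.
apply: (@continuous_comp _ _ _ (fun z : M * N => a z.1 + h) (chart_inv a)); last first.
  exact: chart_inv_continuous.
apply: (@continuousD _ _ _ (fun z : M * N => a z.1) (fun=> h)); last exact: cst_continuous.
apply: (@continuous_comp _ _ _ (@fst M N) a); first exact: cvg_fst.
exact: chart_map_continuous.
Qed.

Lemma shift_chart_open (a : chart R n M) (h : 'rV[R]_n) :
  open [set z : M * N | chart_dom a z.1 /\ chart_img a (a z.1 + h)].
Proof.
rewrite openE => z [az ah]; apply: filterI.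
  by apply: (cvg_fst (F := nbhs z.1) (G := nbhs z.2)); apply: open_nbhs_nbhs; split=> //; apply: chart_dom_open.
have ca : {for z, continuous (fun z : M * N => a z.1 + h)}.
  apply: (@continuousD _ _ _ (fun z : M * N => a z.1) (fun=> h)); last exact: cst_continuous.
  apply: (@continuous_comp _ _ _ (@fst M N) a); first exact: cvg_fst.
  exact: chart_map_continuous.
by apply: (ca (chart_img a)); apply: open_nbhs_nbhs; split=> //; apply: chart_img_open.
Qed.

(** The increment of [F] along a fixed rational vector in a chart is a Borel
    function of the pair: translating in the chart is continuous, and [F] is Borel
    in the pair even though nothing relates its slices. *)
Theorem borel_critical (F : M * N -> R) (a : chart R n M) : borel_fun F ->
  (forall y u, chart_img a u -> {for u, continuous (fun v => F (chart_inv a v, y))}) ->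
  borel [set z : M * N | chart_dom a z.1 /\
    has_gradient (fun u => F (chart_inv a u, z.2)) (a z.1) 0].
Proof.
move=> bF cF; pose G (z : M * N) (h : 'rV[R]_n) := `|F (chart_inv a (a z.1 + h), z.2) - F z|.
pose A := [set z : M * N | chart_dom a z.1].
pose D (h : 'rV[rat]_n) :=
  [set z : M * N | chart_dom a z.1 /\ chart_img a (a z.1 + ratv R h)].
have -> : [set z : M * N | chart_dom a z.1 /\
      has_gradient (fun u => F (chart_inv a u, z.2)) (a z.1) 0] =
    A `&` [set z | forall e : R, 0 < e -> exists2 r : R, 0 < r &
    forall h, `|h| < r -> G z h <= e * `|h|].
  have dot0 v : dot (0 : 'rV[R]_n) v = 0 by rewrite dotC dot0r.
  apply/seteqP; split=> -[x y] /= [ax cxy]; split=> // e /cxy[r r0 rP]; exists r => // h.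
    move=> hr; have := rP (a x + h); rewrite addrC addKr dot0 subr0 => /(_ hr).
    by rewrite chart_mapK.
  by move=> /rP; rewrite /G /= (addrC (a x)) subrK dot0 subr0 chart_mapK.
have openD h : open (D h) by exact: shift_chart_open.
apply: (borel_little_o (D := D)).
- apply: borel_open; rewrite (_ : A = fst @^-1` chart_dom a) //.
  by apply: open_comp => [? _|]; [exact: cvg_fst | exact: chart_dom_open].
- move=> h s; pose t (z : M * N) := (chart_inv a (a z.1 + ratv R h), z.2).
  have bt (B : set R) : borel B -> borel (D h `&` (F \o t) @^-1` B).
    move=> bB; rewrite comp_preimage; apply: borel_preimage_open => //; last exact: bF.
    by move=> z [az ah]; apply: shift_chart_continuous.
  have bgt (q : R) : borel [set r : R | q < r].
    by apply: borel_open; exact: open_gt.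
  have blt (q : R) : borel [set r : R | r < q].
    by apply: borel_open; exact: open_lt.
  rewrite (_ : _ `&` _ = D h `\` [set z | exists q : rat,
     ((D h `&` (F \o t) @^-1` [set r | ratr q < r]) `&` F @^-1` [set r | r < ratr q - s] `|`
      (D h `&` (F \o t) @^-1` [set r | r < ratr q]) `&` F @^-1` [set r | ratr q + s < r]) z]).
    apply: borelD; first exact: borel_open.
    apply: borel_exists => q; apply: borelU; apply: borelI.
    - exact: bt.
    - exact: bF.
    - exact: bt.
    - exact: bF.
  apply/seteqP; split=> z [Dz /= Gz]; split=> //.
    move: Gz; rewrite /G ler_norml => /andP[lo hi] [q].
    by case=> -[[_ /= ?] /= ?]; move: lo hi; rewrite -/(t z); lra.
  rewrite leNgt; apply/negP => sG; apply: Gz.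
  have [|] := leP (F z) (F (t z)) => Fz.
    have [|q] := @rat_in_itvoo R (F z + s) (F (t z)).
      by move: sG; rewrite /G -/(t z) ger0_norm ?subr_ge0 //; lra.
    by rewrite in_itv /= => /andP[? ?]; exists q; left; split; [split | rewrite /=; lra].
  have [|q] := @rat_in_itvoo R (F (t z)) (F z - s).
    by move: sG; rewrite /G -/(t z) ltr0_norm ?subr_lt0 //; lra.
  by rewrite in_itv /= => /andP[? ?]; exists q; right; split; [split | rewrite /=; lra].
- move=> [x y] /= ax.
  have ia : chart_img a (a x) by exists x.
  have [r r0 rU] := open_distP (@chart_img_open _ _ _ a) ia.
  exists r => // h hr; have ah : chart_img a (a x + h).
    by apply: rU; rewrite addrC addKr ltW.
  apply: (@continuous_comp _ _ _ (fun h => F (chart_inv a (a x + h), y) - F (x, y)) Num.norm); last exact: norm_continuous.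
  apply: continuousB; last exact: cst_continuous.
  apply: (@translate_continuousr _ _ _ (fun u => F (chart_inv a u, y))).
  exact: cF.
- move=> [x y] /= ax.
  have ia : chart_img a (a x) by exists x.
  have [r r0 rU] := open_distP (@chart_img_open _ _ _ a) ia.
  by exists r => // h hr; split=> //=; apply: rU; rewrite addrC addKr ltW.
Qed.

End CriticalPoints.

(** * Locally semi-concave functions on a manifold *)

Lemma countable_enum (I : Type) (D : set I) (i0 : I) : countable D -> D i0 ->
  exists e : nat -> I, (forall k, D (e k)) /\ forall i, D i -> exists k, e k = i.
Proof.
move=> /countable_injP[f injf] Di0.
have /choice[e eP] : forall k, exists i, D i /\ ((exists2 j, D j & f j = k) -> f i = k).
  move=> k; have [[j Dj fj]|no] := pselect (exists2 j, D j & f j = k).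
    by exists j.
  by exists i0; split=> // /no.
exists e; split=> [k|i Di]; first by case: (eP k).
exists (f i); have [De /(_ (ex_intro2 _ _ i Di erefl)) fe] := eP (f i).
by apply: injf; rewrite ?inE.
Qed.

(** The members of a countable basis that are small enough form a cover. *)
Lemma countable_subcover (T : topologicalType) (Q : set T -> Prop) :
  @second_countable T -> (forall A B, A `<=` B -> Q B -> Q A) ->
  (forall x : T, exists2 A, nbhs x A & Q A) ->
  exists BB : set (set T), [/\ countable BB, forall B, BB B -> open B /\ Q B &
    forall x, exists2 B, BB B & B x].
Proof.
move=> [BB cBB [oBB baseBB]] Qsub Qloc; exists (BB `&` Q); split.
- by apply: sub_countable cBB; apply: subset_card_le => B [].
- by move=> B [/oBB].
- move=> x; have [A nA QA] := Qloc x; have [B [BBB Bx] BA] := baseBB x A nA.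
  by exists B => //; split=> //; apply: Qsub QA.
Qed.

Section ManifoldSemiconcave.
Context (R : realType) (n : nat) (M : topologicalType).
Context (S : smooth_structure R n M).
Implicit Types (a b : chart R n M) (x : M) (f g : M -> R).

Lemma countable_atlas : @second_countable M ->
  exists AA : set (chart R n M), [/\ countable AA, AA `<=` atlas S &
    forall x, exists2 a, AA a & chart_dom a x].
Proof.
move=> scM; pose Q (B : set M) := exists2 a, atlas S a & B `<=` chart_dom a.
have [| |BB [cBB BBQ BBx]] := @countable_subcover M Q scM.
- by move=> A B AB [a Sa Ba]; exists a => // x /AB/Ba.
- move=> x; have [a Sa ax] := atlas_cover S x; exists (chart_dom a); last by exists a.
  by apply: open_nbhs_nbhs; split=> //; apply: chart_dom_open.
have [[B0 BB0]|no] := pselect (exists B, BB B); last first.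
  exists set0; split=> [||x]; [exact: countable0 | by [] |].
  by have [B BBB _] := BBx x; case: no; exists B.
have [a0 _ _] := proj2 (BBQ B0 BB0).
have /choice[a aP] B : exists a, BB B -> atlas S a /\ B `<=` chart_dom a.
  have [BBB|no] := pselect (BB B); last by exists a0.
  by have [_ [a Sa Ba]] := BBQ B BBB; exists a.
exists (a @` BB); split.
- by apply: sub_countable cBB; apply: card_image_le.
- by move=> _ [B BBB <-]; case: (aP B BBB).
- by move=> x; have [B BBB Bx] := BBx x; exists (a B); [exists B | case: (aP B BBB) => _; apply].
Qed.

Lemma suslin_manifold (x0 : M) : @second_countable M -> suslin [set: M].
Proof.
move=> scM; have [AA [cAA _ AAx]] := countable_atlas scM.
have [a0 AAa0 _] := AAx x0; have [e [_ eP]] := countable_enum cAA AAa0.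
rewrite (_ : setT = \bigcup_k (chart_inv (e k) @` ([set: 'rV[R]_n] `&` chart_img (e k)))).
  apply: suslin_bigcup => k; apply: suslin_image => [u [_ eu]|].
    exact: chart_inv_continuous.
  apply: suslin_setI_open; last exact: chart_img_open.
  exact: (polish_suslin (0 : 'rV[R]_n) (@polish_rV R n)).
apply/seteqP; split=> // x _; have [a AAa ax] := AAx x; have [k ek] := eP a AAa.
exists k => //; exists (e k x); last by rewrite chart_mapK // ek.
by split=> //; rewrite ek; exists x.
Qed.

(** Being read in all charts of the atlas, local semi-concavity has to be moved
    from the covering charts to the others. *)
Lemma locally_semiconcave_cover (AA : set (chart R n M)) f :
  AA `<=` atlas S -> (forall x, exists2 a, AA a & chart_dom a x) ->
  (forall a, AA a -> exists2 w : R -> R, modulus w &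
     semiconcave w (chart_img a) (f \o chart_inv a)) ->
  locally_semiconcave S f.
Proof.
move=> AAS AAx fAA b Sb u [x bx <-]; have [a AAa ax] := AAx x.
have [w mw scf] := fAA a AAa.
have oW : open (overlap b a) by exact: overlap_open.
have Wx : overlap b a (b x) by exists x.
have oV : open (chart_img a) by exact: chart_img_open.
have ta v : overlap b a v -> chart_img a (transition b a v).
  by move=> [z [bz az] <-]; rewrite transition_at //; exists z.
have [v vba|X [oX Xu XW scX]] := @locally_semiconcave_comp _ _ _ _ _ _ _ _
  (f \o chart_inv b) _ oW Wx (transition_smooth Sb (AAS a AAa) 2) oV ta mw scf.
  by rewrite /= (transitionK vba).
by exists X; split=> // v /XW; rewrite overlapE => -[].
Qed.

Lemma locally_semiconcave_continuous_chart f a u : locally_semiconcave S f ->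
  atlas S a -> chart_img a u -> {for u, continuous (f \o chart_inv a)}.
Proof.
move=> scf Sa au; have [V [oV Vu _ [w mw scV]]] := scf a Sa u au.
exact: semiconcave_continuous mw oV Vu scV.
Qed.

Lemma locally_semiconcave_continuous f : locally_semiconcave S f -> continuous f.
Proof.
move=> scf x; have [a Sa ax] := atlas_cover S x.
have cfa : {for a x, continuous (f \o chart_inv a)}.
  by apply: locally_semiconcave_continuous_chart => //; exists x.
have caf : f (chart_inv a (a z)) @[z --> x] --> f (chart_inv a (a x)).
  by apply: (continuous_comp _ cfa); apply: chart_map_continuous.
rewrite chart_mapK // in caf; apply: cvg_trans caf.
apply: near_eq_cvg; have nax : nbhs x (chart_dom a).
  by apply: open_nbhs_nbhs; split=> //; apply: chart_dom_open.
by apply: filterS nax => z az /=; rewrite chart_mapK.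
Qed.

Lemma locally_semiconcave_near f a x : locally_semiconcave S f ->
  atlas S a -> chart_dom a x ->
  exists p, near_supergradient (f \o chart_inv a) (a x) p.
Proof.
move=> scf Sa ax; have au : chart_img a (a x) by exists x.
have [V [oV Vu _ [w mw scV]]] := scf a Sa (a x) au.
have [p pu] := proj1 (semiconcaveP _ _ _) scV _ Vu.
by exists p; apply: supergradient_near pu.
Qed.

Lemma modulusD (w v : R -> R) : modulus w -> modulus v -> modulus (fun r => w r + v r).
Proof.
move=> [cw wm w0 w00] [cv vm v0 v00]; split.
- move=> r; exact: cvgD (cw r) (cv r).
- by move=> r s r0 rs; rewrite lerD ?wm ?vm.
- by move=> r r0; rewrite addr_ge0 ?w0 ?v0.
- by rewrite w00 v00 addr0.
Qed.

Lemma semiconcave_le (w v : R -> R) (U : set 'rV[R]_n) (h : 'rV[R]_n -> R) :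
  (forall r, 0 <= r -> w r <= v r) -> semiconcave w U h -> semiconcave v U h.
Proof.
move=> wv sc x Ux; have [l lP] := sc x Ux; exists l => y Uy.
by apply: le_trans (lP y Uy) _; rewrite lerD2l ler_wpM2l // wv.
Qed.

(** A minimum is the infimum of a family of two functions; the sum of their moduli
    is a common modulus. *)
Lemma locally_semiconcave_min f g : locally_semiconcave S f ->
  locally_semiconcave S g -> locally_semiconcave S (fun x => Num.min (f x) (g x)).
Proof.
move=> scf scg a Sa u au.
have [V [oV Vu VU [w mw scV]]] := scf a Sa u au.
have [X [oX Xu XU [v mv scX]]] := scg a Sa u au.
exists (V `&` X); split=> //; [exact: openI | by move=> z [/VU] |].
exists (fun r => w r + v r); first exact: modulusD.
pose h (b : bool) := (if b then f else g) \o chart_inv a.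
apply: (@semiconcave_inf _ _ _ setT h _ _ _ (modulusD mw mv) (openI oV oX)).
  move=> [] _ /=.
    apply: semiconcave_le (semiconcave_sub (@subIsetl _ _ _) scV) => r r0.
    by rewrite lerDl; case: mv => _ _ + _; apply.
  apply: semiconcave_le (semiconcave_sub (@subIsetr _ _ _) scX) => r r0.
  by rewrite lerDr; case: mw => _ _ + _; apply.
move=> x _; split=> [[] _ /=|e e0]; rewrite ?ge_min ?lexx ?orbT //.
rewrite /=; case: leP => fg; [by exists true => //=; rewrite ltrDl | by exists false => //=; rewrite ltrDl].
Qed.

Lemma differentiable_atN f x : differentiable_at S f x <->
  differentiable_at S (fun z => - f z) x.
Proof.
have [a Sa ax] := atlas_cover S x; pose ca : chart_at S x := exist _ a (conj Sa ax).
split=> /(differentiable_atP _ ca)[p fp]; apply/(differentiable_atP _ ca); exists (- p).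
  exact: has_gradientN fp.
have := has_gradientN fp; congr (has_gradient _ _ _).
by apply/funext => z /=; rewrite opprK.
Qed.

Lemma nondifferentiable_borel f : @second_countable M -> locally_semiconcave S f ->
  borel [set x | ~ differentiable_at S f x].
Proof.
move=> scM scf; have [AA [cAA AAS AAx]] := countable_atlas scM.
rewrite (_ : [set _ | _] = \bigcup_(a in AA) (chart_dom a `\` (chart_dom a `&` a @^-1`
   (chart_img a `&` [set u | exists p, has_gradient (f \o chart_inv a) u p])))).
  apply: borel_bigcup => // a AAa; apply: borelD.
    by apply: borel_open; apply: chart_dom_open.
  apply: borel_preimage_open; first exact: chart_dom_open.
    exact: chart_map_continuous.
  by apply: borel_differentiability; [apply: chart_img_open | apply: scf; apply: AAS].
apply/seteqP; split=> [x nd|x [a AAa [ax nd]] /=].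
  have [a AAa ax] := AAx x; exists a => //; split=> // -[_ [_ fx]]; apply: nd.
  exact/(differentiable_atP f (exist _ a (conj (AAS a AAa) ax) : chart_at S x)).
move=> /(differentiable_atP f (exist _ a (conj (AAS a AAa) ax) : chart_at S x))fx.
by apply: nd; split=> //; split=> //; exists x.
Qed.

Lemma countably_lipschitz_sub (A B : set 'rV[R]_n) : A `<=` B ->
  countably_lipschitz_on B -> countably_lipschitz_on A.
Proof. by move=> AB [KK [cKK KKP BKK]]; exists KK; split=> // x /AB/BKK. Qed.

Lemma countably_lipschitz_bigcup (A : nat -> set 'rV[R]_n) :
  (forall k, countably_lipschitz_on (A k)) -> countably_lipschitz_on (\bigcup_k A k).
Proof.
move=> /choice[KK KKP]; exists (\bigcup_k KK k); split.
- by apply: bigcup_countable => // k _; case: (KKP k).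
- by move=> K [k _ KK_K]; case: (KKP k) => _ + _; apply.
- by move=> x [k _ Ax]; have [_ _ /(_ x Ax)[K KK_K Kx]] := KKP k; exists K => //; exists k.
Qed.

Lemma nondifferentiable_lipschitz f : locally_semiconcave S f ->
  countably_lipschitz S [set x | ~ differentiable_at S f x].
Proof.
move=> scf a Sa; apply: countably_lipschitz_sub (countably_lipschitz_nondifferentiable (scf a Sa)).
move=> _ [x [nd ax] <-]; split; first by exists x.
by move=> fx; apply: nd; apply/(differentiable_atP f (exist _ a (conj Sa ax) : chart_at S x)).
Qed.

End ManifoldSemiconcave.

(** * Semi-convex approximations of the potential *)

Section Infima.
Context (R : realType) (X I : Type) (g : I -> X -> R).

(** Infimum of the functions [g i], [i] in [Y], in the form used by
    [semiconcave_inf]. *)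
Definition inf_of (Y : set I) (f : X -> R) : Prop :=
  forall x, (forall i, Y i -> f x <= g i x) /\
    forall e, 0 < e -> exists2 i, Y i & g i x < f x + e.

Lemma inf_of_exists (Y : set I) : Y !=set0 ->
  (forall x, exists m, forall i, Y i -> m <= g i x) -> exists f, inf_of Y f.
Proof.
move=> [i0 Yi0] lb; exists (fun x => inf [set g i x | i in Y]) => x.
have hi : has_inf [set g i x | i in Y].
  split; first by exists (g i0 x); exists i0.
  by have [m mP] := lb x; exists m => _ [i Yi <-]; apply: mP.
split=> [i Yi|e e0]; first by apply: ge_inf; [case: hi | exists i].
by have [_ [i Yi <-] gi] := inf_adherent e0 hi; exists i.
Qed.

Lemma inf_of_le (Y Z : set I) f h : Z `<=` Y -> inf_of Y f -> inf_of Z h ->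
  forall x, f x <= h x.
Proof.
move=> ZY fY hZ x; apply/ler_addgt0Pl => e e0.
have [i /ZY Yi gi] := proj2 (hZ x) e e0; apply: le_trans (proj1 (fY x) i Yi) _.
by rewrite addrC ltW.
Qed.

Lemma inf_of_unique (Y : set I) f h : inf_of Y f -> inf_of Y h -> f = h.
Proof.
move=> fY hY; apply/funext => x; apply/eqP; rewrite eq_le.
by rewrite (inf_of_le (@subset_refl _ Y) fY hY) (inf_of_le (@subset_refl _ Y) hY fY).
Qed.

Lemma inf_ofU (Y Z : set I) f h : inf_of Y f -> inf_of Z h ->
  inf_of (Y `|` Z) (fun x => Num.min (f x) (h x)).
Proof.
move=> fY hZ x; split=> [i [Yi|Zi]|e e0].
- by rewrite ge_min (proj1 (fY x) i Yi).
- by rewrite ge_min (proj1 (hZ x) i Zi) orbT.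
- have [fh|fh] := leP (f x) (h x).
    by have [i Yi gi] := proj2 (fY x) e e0; exists i => //; left.
  by have [i Zi gi] := proj2 (hZ x) e e0; exists i => //; right.
Qed.

Lemma inf_of1 i : inf_of [set i] (g i).
Proof. by move=> x; split=> [_ -> //|e e0]; exists i => //; rewrite ltrDl. Qed.

End Infima.

Section Approximation.
Context (R : realType) (n : nat) (M : topologicalType).
Context (S : smooth_structure R n M) (N : topologicalType) (c : M * N -> R).
Context (phi : M -> \bar R) (psi : N -> \bar R) (y1 : N).
Hypothesis polishN : polish_space R N.
Hypothesis c_bounded_below : exists m : R, forall z, m <= c z.
Hypothesis c_semiconcave : semiconcave_locally_uniformly S c.
Hypothesis subsol : c_subsolution c phi psi.
Hypothesis psi_y1 : psi y1 != -oo%E.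

Let g (y : N) (x : M) : R := c (x, y) - fine (psi y).

Lemma semiconcave_slice y : locally_semiconcave S (fun x => c (x, y)).
Proof.
have [V nV [AA [AAS AAx scAA]]] := c_semiconcave y.
apply: (locally_semiconcave_cover AAS) => [x|a /scAA[w mw wP]].
  have : (\bigcup_(a in AA) chart_dom a) x by rewrite AAx.
  by move=> [a AAa ax]; exists a.
by exists w => //; apply: (wP y); apply: nbhs_singleton.
Qed.

(** The infimum is taken in the charts where the modulus is common, and only then
    moved to the others. *)
Lemma semiconcave_uniform_inf (V Y : set N) (f : M -> R) :
  uniformly_locally_semiconcave S V (fun y x => c (x, y)) -> Y `<=` V ->
  inf_of g Y f -> locally_semiconcave S f.
Proof.
move=> [AA [AAS AAx scAA]] YV infY.
apply: (locally_semiconcave_cover AAS) => [x|a AAa].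
  have : (\bigcup_(a in AA) chart_dom a) x by rewrite AAx.
  by move=> [a AAa ax]; exists a.
have [w mw wP] := scAA a AAa; exists w => //.
apply: (@semiconcave_inf _ _ _ Y (fun y => g y \o chart_inv a)) => //.
- exact: chart_img_open.
- move=> y /YV/wP sc u au; have [l lP] := sc u au; exists l => v av.
  by have := lP v av; rewrite /g /=; lra.
- by move=> u _; exact: infY.
Qed.

(** The point [y1] only keeps the index sets nonempty. Bounding [psi] makes the
    infima finite, and for each piece of a countable cover of [N] the functions
    [c (., y)] have a common modulus in suitable charts, while different pieces
    may need different charts. *)
Definition index_set (V : nat -> set N) (k j : nat) : set N :=
  y1 |` [set y | [/\ psi y != -oo%E, (psi y <= k%:R%:E)%E &
    exists2 i, (i < j)%N & V i y]].

Lemma psi_fine y : psi y != -oo%E -> psi y = (fine (psi y))%:E.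
Proof. by move=> yN; rewrite fineK // fin_numE yN; case: subsol => _ ->. Qed.

Lemma bounded_inf (Y : set N) (B : R) : Y !=set0 ->
  (forall y, Y y -> fine (psi y) <= B) -> exists f, inf_of g Y f.
Proof.
move=> Y0 YB; apply: inf_of_exists => // x; have [m mP] := c_bounded_below.
by exists (m - B) => y /YB yB; apply: lerB.
Qed.

Lemma index_set_inf V k j : exists f, inf_of g (index_set V k j) f.
Proof.
apply: (@bounded_inf _ (Num.max (fine (psi y1)) k%:R)); first by exists y1; left.
move=> y [->|[yN yk _]]; rewrite le_max ?lexx //; apply/orP; right.
by move: yk; rewrite (psi_fine yN) lee_fin.
Qed.

(** Induction on the number of pieces of the cover: each new piece replaces the
    infimum by a minimum with a function that is semi-concave for its own charts. *)
Lemma index_set_semiconcave V k j f :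
  (forall i, uniformly_locally_semiconcave S (V i) (fun y x => c (x, y))) ->
  inf_of g (index_set V k j) f -> locally_semiconcave S f.
Proof.
move=> scV; elim: j f => [|j IH] f infj.
  have setE : index_set V k 0 = [set y1].
    by apply/seteqP; split=> y; [case=> [->|[_ _ []]] | left].
  rewrite setE in infj; rewrite (inf_of_unique infj (inf_of1 g y1)).
  move=> a Sa u au; have [X [oX Xu XU [w mw sc]]] := semiconcave_slice y1 Sa au.
  exists X; split=> //; exists w => // v Xv; have [l lP] := sc v Xv.
  by exists l => z Xz; have := lP z Xz; rewrite /g /=; lra.
pose Y := [set y | [/\ psi y != -oo%E, (psi y <= k%:R%:E)%E & V j y]].
have setE : index_set V k j.+1 = index_set V k j `|` Y.
  apply/seteqP; split=> y.
    case=> [->|[yN yk [i]]]; first by left; left.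
    rewrite ltnS leq_eqVlt => /orP[/eqP->|ij] Vy; first by right.
    by left; right; split=> //; exists i.
  case=> [[->|[yN yk [i ij Vy]]]|[yN yk Vy]]; first by left.
    by right; split=> //; exists i => //; apply: ltnW.
  by right; split=> //; exists j.
have [h infh] := index_set_inf V k j.
have [Y0|/set0P Y0] := eqVneq Y set0.
  by rewrite setE Y0 setU0 in infj; apply: IH.
have [|d infd] := @bounded_inf Y k%:R Y0.
  by move=> y [yN + _]; rewrite {1}(psi_fine yN) lee_fin.
rewrite setE in infj; rewrite (inf_of_unique infj (inf_ofU infh infd)).
apply: locally_semiconcave_min; first exact: IH.
by apply: (semiconcave_uniform_inf (scV j) _ infd) => y [].
Qed.

(** Above a point of the contact set the supremum defining the potential is
    attained, and it is attained at a point that enters the index sets at some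
    stage; from then on the approximation equals the potential there. *)
Lemma semiconvex_approximation : exists phi_ : nat -> M -> R,
  [/\ forall k, locally_semiconvex S (phi_ k),
      forall k x, phi_ k x <= phi_ k.+1 x,
      forall k x, ((phi_ k x)%:E <= phi x)%E &
      forall x y, contact_set c phi psi (x, y) ->
        exists k0, forall k, (k0 <= k)%N -> (phi_ k x)%:E = phi x /\
          (forall x', phi_ k x - phi_ k x' <= c (x', y) - c (x, y))].
Proof.
pose Q V := uniformly_locally_semiconcave S V (fun y x => c (x, y)).
have [| |BB [cBB BBQ BBx]] := @countable_subcover N Q (polish_second_countable y1 polishN).
- move=> A B AB [AA [AAS AAx scAA]]; exists AA; split=> // a /scAA[w mw wP].
  by exists w => // y /AB; apply: wP.
- by move=> y; have [V nV QV] := c_semiconcave y; exists V.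
have [B1 BB1 _] := BBx y1; have [V [BBV VP]] := countable_enum cBB BB1.
have scV i : Q (V i) by case: (BBQ _ (BBV i)).
have /choice[f fP] k := index_set_inf V k k.
have sub_index k : index_set V k k `<=` index_set V k.+1 k.+1.
  move=> y [->|[yN yk [i ik Vy]]]; [by left | right; split=> //].
    by apply: le_trans yk _; rewrite lee_fin ler_nat.
  by exists i => //; apply: leqW.
have index_fin k y : index_set V k k y -> psi y != -oo%E by move=> [->|[]].
have fphi k x : ((- f k x)%:E <= phi x)%E.
  case: subsol => phiN psiP sub; case E : (phi x) => [r| |]; last first.
  - by have := phiN x; rewrite E.
  - exact: leey.
  rewrite lee_fin lerNl; apply/ler_addgt0Pl => e e0; rewrite addrC.
  have [y ky gy] := proj2 (fP k x) e e0; apply: le_trans (ltW gy).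
  have := sub x y; rewrite E (psi_fine (index_fin k y ky)) -EFinB lee_fin /g; lra.
(* The approximations are suprema, hence opposites of infima of the opposite
   functions. *)
exists (fun k x => - f k x); split=> // [k|k x|x y].
- rewrite /locally_semiconvex (_ : (fun x => _) = f k).
    by apply: index_set_semiconcave (fP k).
  by apply/funext => x; rewrite opprK.
- by rewrite lerN2; apply: inf_of_le (fP k.+1) (fP k) x.
rewrite /contact_set /= => Gxy.
have [yN [r Er]] : psi y != -oo%E /\ exists r, phi x = r%:E.
  case: subsol => phiN psiP _; have := phiN x; have := psiP y.
  by move: Gxy; case: (psi y) (phi x) => [s| |] [r| |] //= _ _ _; split=> //; exists r.
move: Gxy; rewrite Er {1}(psi_fine yN) -EFinB => -[Gxy].
have [B BBB By] := BBx y; have [i Vi] := VP B BBB.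
exists (maxn i.+1 (Num.bound `|fine (psi y)|)) => k; rewrite geq_max => /andP[ik yk].
have ky : index_set V k k y.
  right; split=> //; last by exists i => //; rewrite Vi.
  rewrite (psi_fine yN) lee_fin; apply: le_trans (ler_norm _) (le_trans (ltW _) _).
    exact: archi_boundP (normr_ge0 _).
  by rewrite ler_nat.
have fx : - f k x = r.
  apply/eqP; rewrite eq_le; have := fphi k x; rewrite Er lee_fin => -> /=.
  by have := proj1 (fP k x) y ky; rewrite /g; lra.
split=> [|x']; first by rewrite fx.
by have := proj1 (fP k x') y ky; rewrite fx /g; lra.
Qed.

End Approximation.

(** * The contact map *)

Section ContactMap.
Context (R : realType) (n : nat) (M : topologicalType).
Context (S : smooth_structure R n M) (N : topologicalType) (c : M * N -> R).

Lemma locally_semiconvex_continuous (f : M -> R) :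
  locally_semiconvex S f -> continuous f.
Proof.
move=> scf x; rewrite (_ : f = fun z => - (- f z)); last first.
  by apply/funext => z; rewrite opprK.
apply: (@continuous_comp _ _ _ (fun z => - f z) (@GRing.opp R)).
  have cNf : continuous (fun z => - f z) by exact: locally_semiconcave_continuous scf.
  exact: cNf.
exact: opp_continuous.
Qed.

Lemma atlas_chart_at (x : M) : chart_at S x.
Proof. by apply: cid; have [a Sa ax] := atlas_cover S x; exists a. Qed.

(** The difference of the two functions has a minimum at [x]. *)
Lemma differential_touch (f h : M -> R) x : (forall z, f z <= h z) -> f x = h x ->
  differentiable_at S f x -> differentiable_at S h x ->
  differential S f x = differential S h x.
Proof.
move=> fh fhx df dh; have a := atlas_chart_at x.
have /(differentiable_atP _ a)[p fp] := df; have /(differentiable_atP _ a)[q hq] := dh.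
have ax := proj2 (svalP a).
have pq : p = q.
  apply: (has_gradient_touch ltr01 _ _ fp hq) => [|u _]; last exact: fh.
  by rewrite /= chart_mapK.
apply: (covector_ext (a := a)) => v.
rewrite -pq in hq; exact: etrans (differentialE fp v) (esym (differentialE hq v)).
Qed.

(** If [f] dominates [- c (., y)] up to a constant with equality at [x], then the
    semi-concave function [c (., y)] lies above the differentiable function [- f]
    with contact at [x], so it is differentiable at [x]. *)
Lemma left_twist_contact (f : M -> R) x y :
  locally_semiconcave S (fun x => c (x, y)) -> differentiable_at S f x ->
  (forall x', f x - f x' <= c (x', y) - c (x, y)) ->
  left_twist_dom S c (x, y) /\
  left_twist S c (x, y) = existT _ x (covec_opp (differential S f x)).
Proof.
move=> scc df fc; have a := atlas_chart_at x; have [Sa ax] := svalP a.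
have /(differentiable_atP _ a)[q fq] := df; apply/(left_twist_gradient _ _ fq).
have [p cp] := locally_semiconcave_near scc Sa ax.
apply: (has_gradient_squeeze ltr01 _ (has_gradientN fq) cp) => u _ /=.
by have := fc (chart_inv (sval a) u); rewrite chart_mapK //; lra.
Qed.

(** Read in charts, the equation for the differentials says that [x] is a critical
    point of [c (., y) + f], and countably many charts suffice. *)
Lemma left_twist_borel (f : M -> R) (C : set M) : @second_countable M ->
  borel_fun c -> (forall y, locally_semiconcave S (fun x => c (x, y))) ->
  locally_semiconvex S f -> borel C -> (forall x, C x -> differentiable_at S f x) ->
  borel [set z : M * N | C z.1 /\ (left_twist_dom S c z /\
    left_twist S c z = existT _ z.1 (covec_opp (differential S f z.1)))].
Proof.
move=> scM bc scc scf bC df; have [AA [cAA AAS AAx]] := countable_atlas S scM.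
have cf : continuous f by exact: locally_semiconvex_continuous scf.
pose F (z : M * N) := c z + f z.1.
have bF : borel_fun F.
  apply: borel_funD => // B bB; apply: (borel_preimage _ bB) => z.
  by apply: (@continuous_comp _ _ _ fst f); [exact: cvg_fst | exact: cf].
have cF a y u : atlas S a -> chart_img a u ->
    {for u, continuous (fun v => F (chart_inv a v, y))}.
  move=> Sa au; apply: continuousD.
    exact: (locally_semiconcave_continuous_chart (scc y) Sa au).
  by apply: (@continuous_comp _ _ _ (chart_inv a) f); [exact: chart_inv_continuous | exact: cf].
rewrite (_ : [set z | _] = fst @^-1` C `&` \bigcup_(a in AA) [set z : M * N |
    chart_dom a z.1 /\ has_gradient (fun u => F (chart_inv a u, z.2)) (a z.1) 0]).
  apply: borelI; first by apply: borel_preimage => // z; exact: cvg_fst.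
  apply: borel_bigcup => // a AAa; apply: borel_critical => // y u au.
  by apply: cF => //; apply: AAS.
have crit a x y : AA a -> chart_dom a x -> C x ->
    (left_twist_dom S c (x, y) /\
     left_twist S c (x, y) = existT _ x (covec_opp (differential S f x))) <->
    has_gradient (fun u => F (chart_inv a u, y)) (a x) 0.
  move=> AAa ax Cx; pose ca : chart_at S x := exist _ a (conj (AAS a AAa) ax).
  have /(differentiable_atP _ ca)[q fq] := df x Cx.
  apply: iff_trans (left_twist_gradient c y fq) _; split=> [cq|Fq].
    by have := has_gradientD cq fq; rewrite addNr.
  have := has_gradientD Fq (has_gradientN fq); rewrite add0r.
  by congr (has_gradient _ _ _); apply/funext => u; rewrite /F /= addrK.
apply/seteqP; split=> [[x y] [Cx tw]|[x y] [Cx [a AAa [ax cr]]]].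
  split=> //; have [a AAa ax] := AAx x; exists a => //; split=> //.
  exact/(crit a x y AAa ax Cx).
by split=> //; apply/(crit a x y AAa ax Cx).
Qed.

End ContactMap.

Theorem theorem3p1 (R : realType) (n : nat) (M : topologicalType)
    (S : smooth_structure R n M) (N : topologicalType) (c : M * N -> R)
    (phi : M -> \bar R) (psi : N -> \bar R) (ybar : N)
    (hausM : hausdorff_space M) (scM : @second_countable M)
    (polishN : polish_space R N)
    (c_borel : borel_fun c)
    (c_bounded_below : exists m : R, forall z, m <= c z)
    (c_semiconcave : semiconcave_locally_uniformly S c)
    (c_twist : left_twist_condition S c)
    (subsol : c_subsolution c phi psi) :
  let G := contact_set c phi psi in
  let P := fst @` G in
  exists (E : set M) (T : M -> N),
    [/\ borel E, countably_lipschitz S E, borel_fun T,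
        G `<=` graph_of T `|` fst @^-1` E &
        (exists y, psi y != -oo%E) ->
        exists (phi_ : nat -> M -> R) (C : nat -> set M),
          [/\ (forall k, locally_semiconvex S (phi_ k)) /\
              (forall k x, phi_ k x <= phi_ k.+1 x /\
                           ((phi_ k.+1 x)%:E <= phi x)%E),
              (forall k, borel (C k) /\ C k `<=` C k.+1) /\
              (forall k x, C k x ->
                 [/\ differentiable_at S (phi_ k) x,
                     differentiable_at S (phi_ k.+1) x,
                     phi_ k.+1 x = phi_ k x &
                     differential S (phi_ k.+1) x = differential S (phi_ k) x]),
              P `\` E `<=` \bigcup_k C k,
              (forall k x, C k x ->
                 (x, T x) = left_twist_inv c ybar
                   (existT _ x (covec_opp (differential S (phi_ k) x)))) &
              forall k x, ((P `&` C k) `\` E) x ->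
                [/\ left_twist_dom S c (x, T x),
                    differential S (fun x' => c (x', T x)) x
                      = covec_opp (differential S (phi_ k) x),
                    left_twist S c (x, T x)
                      = existT _ x (covec_opp (differential S (phi_ k) x)) &
                    forall y, left_twist_dom S c (x, y) ->
                      left_twist S c (x, y)
                        = existT _ x (covec_opp (differential S (phi_ k) x)) ->
                      y = T x]]].
Proof.
move=> G P; have [[y1 psi_y1]|nopsi] := pselect (exists y, psi y != -oo%E); last first.
  (* The contact set is empty: [psi y - phi x] is then never finite. *)
  exists set0, (fun=> ybar); split=> //.
  - exact: borel0.
  - by move=> a _; exists set0; split=> // _ [x [[]]].
  - by move=> B bB; apply: borel_cst.
  - move=> [x y]; rewrite /G /contact_set /= => Gxy; exfalso; apply: nopsi; exists y.
    by apply/eqP => psiy; move: Gxy; rewrite psiy; case: (phi x).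
have [phi_ [sc_phi mono_phi phi_le contact]] :=
  semiconvex_approximation polishN c_bounded_below c_semiconcave subsol psi_y1.
have scc := semiconcave_slice c_semiconcave.
pose E := \bigcup_k [set x | ~ differentiable_at S (phi_ k) x].
pose C k := [set x | (forall l, differentiable_at S (phi_ l) x) /\
                     (forall l, (k <= l)%N -> phi_ l x = phi_ k x)].
have ndN k : [set x | ~ differentiable_at S (phi_ k) x] =
    [set x | ~ differentiable_at S (fun z => - phi_ k z) x].
  apply/seteqP; split=> x /= nd fx; apply: nd.
    exact: (proj2 (differentiable_atN S (phi_ k) x) fx).
  exact: (proj1 (differentiable_atN S (phi_ k) x) fx).
have bnd k : borel [set x | ~ differentiable_at S (phi_ k) x].
  by rewrite ndN; exact: nondifferentiable_borel scM (sc_phi k).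
have bE : borel E by apply: borel_bigcup_nat.
have notE x : ~ E x -> forall l, differentiable_at S (phi_ l) x.
  by move=> nE l; apply: contrapT => nd; apply: nE; exists l.
have cphi k : continuous (phi_ k) by exact: locally_semiconvex_continuous (sc_phi k).
have bC k : borel (C k).
  rewrite (_ : C k = ~` E `&` [set x | forall l, ([set _ | ~ (k <= l)%N] `|`
      (fun x => phi_ l x - phi_ k x) @^-1` [set 0]) x]).
    apply: borelI; first exact: borelC.
    apply: borel_forall => l; apply: borelU; first exact: borel_cst.
    apply: borel_preimage; last by apply: borel_closed; exact: closed_eq.
    by move=> x; apply: continuousB; exact: cphi.
  apply/seteqP; split=> x [dx eqx]; split=> [|l].
  - by move=> [l _]; apply.
  - have [kl|lk] := pselect (k <= l)%N; [right | by left].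
    by rewrite /= eqx // subrr.
  - exact: notE.
  - by move=> kl; case: (eqx l) => // /eqP; rewrite subr_eq0 => /eqP.
have le_phi k l x : (k <= l)%N -> phi_ k x <= phi_ l x.
  by move=> /subnK <-; elim: (l - k)%N => // j IH; apply: le_trans IH (mono_phi _ _).
have same_differential k l x : C k x -> (k <= l)%N ->
    differential S (phi_ k) x = differential S (phi_ l) x.
  move=> [dx eqx] kl; apply: differential_touch => [z|||]; [exact: le_phi | | exact: dx | exact: dx].
  by rewrite eqx.
have subC k l : (k <= l)%N -> C k `<=` C l.
  move=> kl x [dx eqx]; split=> // j lj; rewrite eqx ?(leq_trans kl) //.
  by rewrite [RHS]eqx.
pose twist k x y := left_twist_dom S c (x, y) /\
  left_twist S c (x, y) = existT _ x (covec_opp (differential S (phi_ k) x)).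
(* On [C k] the choice of [k] in [D] is immaterial, by [same_differential]; the
   sections of [D] have at most one point by the twist condition, and outside its
   domain [T] has the default value [ybar], as the inverse twist map does. *)
pose D : set (M * N) := [set z | exists k, C k z.1 /\ twist k z.1 z.2].
have twistD k x y : C k x -> D (x, y) <-> twist k x y.
  move=> Ckx; split=> [[l [Clx tw]]|tw]; last by exists k.
  suff eqd : differential S (phi_ k) x = differential S (phi_ l) x.
    by rewrite /twist eqd.
  have [kl|/ltnW lk] := leqP k l; first exact: same_differential.
  by apply/esym; exact: same_differential.
have bD : borel D.
  apply: borel_exists => k; rewrite (_ : (fun z => _) = [set z : M * N | C k z.1 /\
      (left_twist_dom S c z /\
       left_twist S c z = existT _ z.1 (covec_opp (differential S (phi_ k) z.1)))]).
    by apply: left_twist_borel => // x [].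
  by apply/seteqP; split=> -[x y].
have funD x y y' : D (x, y) -> D (x, y') -> y = y'.
  move=> [k [Ckx tw]] Dxy'; have [dy twy] := tw.
  have [dy' twy'] := proj1 (twistD k x y' Ckx) Dxy'.
  have eqtw : left_twist S c (x, y) = left_twist S c (x, y') := etrans twy (esym twy').
  by have [] := c_twist (x, y) (x, y') (mem_set dy) (mem_set dy') eqtw.
pose T x := xget ybar [set y | D (x, y)].
have TD x y : D (x, y) -> T x = y.
  by move=> Dxy; apply: xget_unique => // y' Dxy'; apply: funD Dxy' Dxy.
have bT : borel_fun T.
  have [[x0 _]|noM] := pselect (exists x : M, True).
    have sM := suslin_manifold S x0 scM.
    have bT := @borel_fun_of_borel_graph R N ybar polishN M D hausM sM bD funD.
    exact: bT.
  move=> B bB; rewrite (_ : _ @^-1` _ = set0); first exact: borel0.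
  by apply/seteqP; split=> // x; case: noM; exists x.
(* The contact set outside [E] is contained in [D]. *)
have GC x y : G (x, y) -> ~ E x -> exists k0, forall k, (k0 <= k)%N ->
    C k x /\ twist k x y.
  move=> Gxy nE; have [k0 k0P] := contact x y Gxy; exists k0 => k k0k.
  have [eqk ck] := k0P k k0k; split; last exact: left_twist_contact (scc y) (notE x nE k) ck.
  split=> [|l kl]; first exact: notE.
  have [eql _] := k0P l (leq_trans k0k kl).
  by have := etrans eql (esym eqk); case.
exists E, T; split=> //.
- move=> a Sa; rewrite (_ : a @` _ = \bigcup_k (a @` ([set x | ~ differentiable_at S (phi_ k) x]
      `&` chart_dom a))).
    apply: countably_lipschitz_bigcup => k; rewrite ndN.
    exact: (nondifferentiable_lipschitz (sc_phi k) Sa).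
  apply/seteqP; split=> u.
    by move=> [x [[k _ nd] ax] <-]; exists k => //; exists x.
  by move=> [k _ [x [nd ax] <-]]; exists x => //; split=> //; exists k.
- move=> [x y] Gxy; have [Ex|nE] := pselect (E x); [by right | left].
  have [k0 k0P] := GC x y Gxy nE; have [Ck tw] := k0P k0 (leqnn _).
  by rewrite /graph_of /= (TD x y) //; exists k0.
move=> _; exists phi_, C; split.
- by split=> // k x; split.
- split=> [k|k x Ckx]; first by split; [exact: bC | apply: subC].
  have [dx eqx] := Ckx.
  split; [exact: dx | exact: dx | exact: eqx (leqnSn k) |].
  exact: esym (same_differential k k.+1 x Ckx (leqnSn k)).
- move=> x [[[x' y] Gxy /= <-] nE]; have [k0 k0P] := GC x' y Gxy nE.
  by exists k0 => //; case: (k0P k0 (leqnn _)).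
- move=> k x Ckx; rewrite /left_twist_inv /=.
  have [[y Dxy]|noD] := pselect (exists y, D (x, y)).
    have tw := proj1 (twistD k x y Ckx) Dxy; rewrite (TD x y Dxy).
    apply/esym; apply: xget_unique => // -[x' y'] /= [dz twz].
    have ex : x' = x by exact: (congr1 (@projT1 _ _) twz).
    subst x'; congr (_, _); apply: (funD x y' y _ Dxy).
    exact: (proj2 (twistD k x y' Ckx) (conj dz twz)).
  rewrite /T xgetPN => [|y Dxy]; last by apply: noD; exists y.
  rewrite xgetPN // => -[x' y'] /= [dz twz]; apply: noD; exists y'.
  have ex : x' = x by exact: (congr1 (@projT1 _ _) twz).
  subst x'; exact: (proj2 (twistD k x y' Ckx) (conj dz twz)).
- move=> k x [[[[x' y] Gxy /= ex] Ckx] nE]; subst x'.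
  have [k0 k0P] := GC x y Gxy nE.
  have [Clx twl] := k0P (maxn k k0) (leq_maxr _ _).
  have Dxy : D (x, y) by exists (maxn k k0).
  have [dy twy] := proj1 (twistD k x y Ckx) Dxy; rewrite (TD x y Dxy).
  split=> //; first exact: cotangent_inj twy.
  move=> y' dy' twy'; apply: (funD x y' y _ Dxy).
  exact: (proj2 (twistD k x y' Ckx) (conj dy' twy')).
Qed.
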